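(* Let $B,C>0$ and $\delta$ be fixed parameters, and for each (sufficiently large) $n$ let $X=X^{(n)}=(X_{ij})$ be uniformly distributed on the set $\mathscr{M}^{\{0,1\}}_{n,\delta}(B,C)$ of binary contingency tables. Let $k=k(n)$ be a sequence of positive integers. Then, as $n\to\infty$: (1) (Bottom right) If $0\le\delta<1$, $0<C<1$, $0<B\le\frac1C$ and $k(n)=o\left(n^{1-\delta}\right)$, then $$d_{TV}\left(\left(X_{[n^\delta]+1,[n^\delta]+1},X_{[n^\delta]+1,[n^\delta]+2},\dots,X_{[n^\delta]+1,[n^\delta]+k}\right),V_k(C)\right)\to0.$$ (2) (Top left) If $\frac12<\delta\le\frac23$, $0<C<\frac34$, $0<B<\dfrac{1}{\sqrt{\frac C3-\frac{C^2}3}+C}$ and $k(n)=o\left(\frac{n^{2\delta-1}}{\log n}\right)$, then $$d_{TV}\left(\left(X_{11},\dots,X_{1k}\right),V_k\left(\frac{B^2(1-C)}{B^2-2B+1/C}\right)\right)\to0.$$ (3) (Side blocks) If $0<\delta\le\frac12$, $0<C<\frac34$, $0<B<\dfrac{1}{\sqrt{\frac C3-\frac{C^2}3}+C}$ and $k(n)=o\left(\frac{n^\delta}{\log n}\right)$, then $$d_{TV}\left(\left(X_{1,[n^\delta]+1},\dots,X_{1,[n^\delta]+k}\right),V_k(BC)\right)\to0.$$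
   Context: $[x]$ denotes the integer part of $x$. For integer vectors $\mathbf r=(r_1,\dots,r_m)$, $\mathbf c=(c_1,\dots,c_l)$ with $\sum_i r_i=\sum_j c_j$, $\mathscr{M}^{\{0,1\}}(\mathbf r,\mathbf c)$ is the set of $m\times l$ matrices with entries in $\{0,1\}$ whose $i$th row sum is $r_i$ and $j$th column sum is $c_j$ for all $i,j$. For $B,C>0$, $0\le\delta\le1$ and $n\ge1$, $\mathscr{M}^{\{0,1\}}_{n,\delta}(B,C):=\mathscr{M}^{\{0,1\}}(\widetilde{\mathbf r},\widetilde{\mathbf c})$, where $\widetilde{\mathbf r}=\widetilde{\mathbf c}\in\mathbb N^{[n^\delta]+n}$ is the vector whose first $[n^\delta]$ entries equal $[BCn]$ and whose remaining $n$ entries equal $[Cn]$. $(R_1,\dots,R_k)$ denotes the joint distribution of the random variables $R_1,\dots,R_k$, and $V_k(\gamma)$ denotes the joint distribution of $k$ i.i.d. $\mathrm{Ber}(\gamma)$ (Bernoulli with mean $\gamma$) random variables. $d_{TV}$ is the total variation distance, $d_{TV}(\mu,\nu)=\frac12\sum_{x}|\mu(x)-\nu(x)|$, the sum being over the countable set $\{0,1\}^k$ on which the laws live. *)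

(* Defs.v *)
From HB Require Import structures.
From mathcomp Require Export all_boot all_order all_algebra.
From mathcomp Require Export all_classical all_reals all_analysis.
Export Order.TTheory GRing.Theory Num.Theory.
Export numFieldNormedType.Exports.

Set Implicit Arguments.
Unset Strict Implicit.
Unset Printing Implicit Defensive.

Local Open Scope ring_scope.

(* Entries are booleans, coerced to 0 and 1 in the row and column sums. *)
Definition binary_tables (m l : nat) (r : 'I_m -> nat) (c : 'I_l -> nat) :
    {set 'M[bool]_(m, l)} :=
  [set M : 'M[bool]_(m, l) |
    [forall i, (\sum_j M i j)%N == r i] && [forall j, (\sum_i M i j)%N == c j]].

Section Margins.
Variable R : realType.
Implicit Types (B C delta : R) (n : nat).

(* [n^delta]; for nonnegative reals, Num.truncn is the integer part. *)
Definition nblock delta n : nat := Num.truncn (n%:R `^ delta).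

Definition margin B C delta n (i : 'I_(nblock delta n + n)) : nat :=
  if (i < nblock delta n)%N then Num.truncn (B * C * n%:R)
  else Num.truncn (C * n%:R).

Definition tables B C delta n :
    {set 'M[bool]_(nblock delta n + n, nblock delta n + n)} :=
  binary_tables (@margin B C delta n) (@margin B C delta n).

End Margins.

(* Entries are numbered from 0, so X_{i+1,j+1} is [entry X i j]; the value
   outside the index range is irrelevant for large n, when the statement only
   looks at indices inside the matrix. *)
Definition entry (m l : nat) (M : 'M[bool]_(m, l)) (i j : nat) : bool :=
  if insub i is Some i' then
    if insub j is Some j' then M i' j' else false
  else false.

Definition segment (m l : nat) (i j k : nat) (M : 'M[bool]_(m, l)) :
    {ffun 'I_k -> bool} :=
  [ffun t : 'I_k => entry M i (j + t)].

Section FiniteLaws.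
Variable R : realType.

(* The zero function when A is empty. *)
Definition uniform_pmf (T : finType) (A : {set T}) (x : T) : R :=
  if x \in A then (#|A|%:R)^-1 else 0.

(* Probability mass function of Y when the sample point has mass function mu. *)
Definition law (T U : finType) (mu : T -> R) (Y : T -> U) (y : U) : R :=
  \sum_(x | Y x == y) mu x.

Definition iid_bernoulli (k : nat) (gamma : R) (x : {ffun 'I_k -> bool}) : R :=
  \prod_(t < k) bernoulli_pmf gamma (x t).

Definition dTV (U : finType) (mu nu : U -> R) : R :=
  2^-1 * \sum_x `|mu x - nu x|.

(* Joint law of (X_{i+1,j+1}, ..., X_{i+1,j+k}), X uniform on the tables. *)
Definition segment_law (B C delta : R) (n i j k : nat) :
    {ffun 'I_k -> bool} -> R :=
  law (uniform_pmf (tables B C delta n)) (segment i j k).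

End FiniteLaws.

Arguments iid_bernoulli {R} k gamma x.
Arguments segment_law {R} B C delta n i j k _.

(* Main.v *)
Require Import Defs.
From mathcomp Require Import perm ring lra zify.

(** The law of a window of [k] entries is compared with its Bernoulli limit through
relative entropy, which controls the total variation distance by
[dTV_relative_entropy].  Two mechanisms make the entropy small.

In the bottom right block, the entries of one row are exchangeable, and their
sum is known up to the [n^delta] entries of the side block.  By the chain rule,
the entropy of [k] of them is at most a sum of [k] chi-square terms; each of them
is the variance of the average of the remaining entries, which is
[O(n^(delta - 1))] because the total is almost deterministic
([relative_entropy_exchangeable]).  So the entropy is [O(k n^(delta - 1))].

In the other blocks, let [Y] be a matrix with independent entries, Bernoulli with
one parameter in each block, such that the odds of the parameters are products
of a row factor and a column factor.  Then the mass that [Y] gives to a matrix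
only depends on its margins, so a uniform table [X] is [Y] conditioned on its
margins, and the entropy of [X] relative to [Y] is minus the logarithm of the
probability of the conditioning event.  Two remarks show that this cost is
[O(n ln n)]:
- among all margins with given totals over the two classes of rows and over the
  two classes of columns, the margins that are constant on the classes carry the
  most tables ([card_tables_balance]), because moving a unit from a larger row
  sum to a smaller one does not decrease the number of tables
  ([card_tables_transfer]); as there are only [n^O(n)] margins, fixing the margins
  costs [O(n ln n)] more than fixing these totals;
- the totals are fixed as soon as the sums over the four blocks are, and these
  are independent binomial variables, asked to take values close to their means
  ([binomial_point_ge], [tables_cost]); this uses [delta <= 2 / 3].

The same count shows that there are tables at all ([card_tables_gt0]).

Now cut the rows of a block into disjoint windows of length [k].  They all have
the same law under [X], since rotating the rows and the columns of a block
preserves the margins, and their entropies add up to at most the total cost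
([relative_entropy_windows]).  The top left block has about [n^(2 delta) / k]
windows and the side block about [n^(1 + delta) / k], so the entropy of one
window is [O(k n^(1 - 2 delta) ln n)] in the former and [O(k n^(- delta) ln n)] in
the latter.  Finally, the parameter of [Y] in the top left block is within
[O(n^(delta - 1))] of its limit, which adds [O(k n^(delta - 1))] to the entropy. *)

Set Implicit Arguments.
Unset Strict Implicit.
Unset Printing Implicit Defensive.

Local Open Scope ring_scope.

(** * Relative entropy and total variation *)

Lemma ln_leB1 (R : realType) (x : R) : 0 < x -> ln x <= x - 1.
Proof.
move=> x0; rewrite -[in leLHS](subrK 1 x) addrC le_ln1Dx//.
by rewrite -subr_gt0 opprK subrK.
Qed.

Section RelativeEntropy.
Variable R : realType.

Definition relative_entropy (U : finType) (p q : U -> R) : R :=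
  \sum_x p x * ln (p x / q x).

Lemma cauchy_schwarz_sum (I : finType) (P : pred I) (f g : I -> R) :
  (\sum_(i | P i) f i * g i) ^+ 2 <=
  (\sum_(i | P i) f i ^+ 2) * (\sum_(i | P i) g i ^+ 2).
Proof.
set F := \sum_(i | _) f i ^+ 2; set G := \sum_(i | _) g i ^+ 2.
set H := \sum_(i | _) f i * g i.
have F0 : 0 <= F by apply: sumr_ge0 => i _; exact: sqr_ge0.
have G0 : 0 <= G by apply: sumr_ge0 => i _; exact: sqr_ge0.
have : 0 <= \sum_(i | P i) (G * f i - H * g i) ^+ 2.
  by apply: sumr_ge0 => i _; exact: sqr_ge0.
have -> : \sum_(i | P i) (G * f i - H * g i) ^+ 2 = G * (F * G - H ^+ 2).
  transitivity (\sum_(i | P i)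
      (G ^+ 2 * f i ^+ 2 - 2 * G * H * (f i * g i) + H ^+ 2 * g i ^+ 2)).
    by apply: eq_bigr => i _; ring.
  rewrite big_split /= sumrB -!mulr_sumr -/F -/G -/H; ring.
move: G0; rewrite le_eqVlt => /orP[/eqP G0 _|G0].
  have g0 i : P i -> g i = 0.
    move=> Pi; apply/eqP; rewrite -sqrf_eq0.
    by have /psumr_eq0P -> // := esym G0 => j _; exact: sqr_ge0.
  rewrite -G0 mulr0 /H big1 ?expr0n// => i Pi; by rewrite g0// mulr0.
by rewrite pmulr_rge0// subr_ge0.
Qed.

(** Pinsker's inequality with a worse constant: [ln x <= x - 1] at the square
    root of the likelihood ratio bounds the squared Hellinger distance by the
    entropy, and Cauchy-Schwarz bounds the total variation by the Hellinger
    distance. *)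
Lemma dTV_relative_entropy (U : finType) (p q : U -> R) :
  (forall x, 0 <= p x) -> (forall x, 0 < q x) ->
  \sum_x p x = 1 -> \sum_x q x = 1 ->
  dTV p q ^+ 2 <= relative_entropy p q.
Proof.
move=> p0 q0 p1 q1.
pose a x := Num.sqrt (p x); pose b x := Num.sqrt (q x).
have a2 x : a x ^+ 2 = p x by rewrite sqr_sqrtr.
have b2 x : b x ^+ 2 = q x by rewrite sqr_sqrtr// ltW.
have a0 x : 0 <= a x by exact: sqrtr_ge0.
have b0 x : 0 < b x by rewrite sqrtr_gt0.
have hell : \sum_x (a x - b x) ^+ 2 <= relative_entropy p q.
  have -> : \sum_x (a x - b x) ^+ 2 = \sum_x 2 * (p x - a x * b x).
    transitivity (\sum_x (2 * (p x - a x * b x) + (q x - p x))).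
      by apply: eq_bigr => x _; rewrite -a2 -b2; ring.
    by rewrite big_split/= sumrB p1 q1 subrr addr0.
  apply: ler_sum => x _.
  have := p0 x; rewrite le_eqVlt => /orP[/eqP px|px].
    by rewrite -px /a -px sqrtr0 !mul0r subrr mulr0.
  have ax : 0 < a x by rewrite sqrtr_gt0.
  have -> : ln (p x / q x) = - (2 * ln (b x / a x)).
    rewrite -a2 -b2 !ln_div ?posrE ?exprn_gt0// !lnXn//; ring.
  have : ln (b x / a x) <= b x / a x - 1 by apply: ln_leB1; rewrite divr_gt0.
  move=> /(ler_wpM2l (ltW px)).
  rewrite mulrBr mulr1 (_ : p x * (b x / a x) = a x * b x); last first.
    by rewrite -a2; field; rewrite gt_eqF.
  by move=> H; nra.
apply: le_trans hell.
have -> : dTV p q = 2^-1 * \sum_x `|a x - b x| * (a x + b x).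
  congr (_ * _); apply: eq_bigr => x _.
  by rewrite -[X in _ * X]ger0_norm ?addr_ge0// ?ltW// -normrM -a2 -b2; congr `|_|; ring.
rewrite exprMn; have := cauchy_schwarz_sum predT (fun x => `|a x - b x|) (fun x => a x + b x).
under [X in _ <= X * _ -> _]eq_bigr => x _ do rewrite real_normK ?num_real//.
set H := \sum_x (_ - _) ^+ 2; set S := \sum_x _ * _; set T := \sum_x (_ + _) ^+ 2 => HS.
have T4 : T <= 4.
  have -> : (4 : R) = \sum_x 2 * (p x + q x) by rewrite -mulr_sumr big_split/= p1 q1; ring.
  by apply: ler_sum => x _; rewrite -a2 -b2; have := sqr_ge0 (a x - b x); nra.
have H0 : 0 <= H by apply: sumr_ge0 => x _; exact: sqr_ge0.
have : H * T <= H * 4 by rewrite ler_wpM2l.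
rewrite (_ : 2^-1 ^+ 2 = 4^-1 :> R); last by field.
move: (S ^+ 2) HS => S2; lra.
Qed.

(** A law keeps its relative entropy up to [k * e] when the reference measure
    is changed to one that dominates it up to a factor [(1 + e) ^+ k]. *)
Lemma relative_entropy_change (U : finType) (p q q' : U -> R) (k : nat) (e : R) :
  0 <= e -> (forall x, 0 <= p x) -> (forall x, 0 < q x) -> (forall x, 0 < q' x) ->
  \sum_x p x = 1 -> (forall x, q x <= (1 + e) ^+ k * q' x) ->
  relative_entropy p q' <= relative_entropy p q + k%:R * e.
Proof.
move=> e0 p0 q0 q0' p1 qq'.
have -> : k%:R * e = \sum_x p x * (k%:R * e) by rewrite -mulr_suml p1 mul1r.
rewrite -big_split/=; apply: ler_sum => x _.
have := p0 x; rewrite le_eqVlt => /orP[/eqP <-|px]; first by rewrite !mul0r addr0.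
rewrite -mulrDr ler_wpM2l//.
have -> : p x / q' x = (p x / q x) * (q x / q' x).
  by field; rewrite !gt_eqF.
rewrite lnM ?posrE ?divr_gt0// lerD2l.
have e1 : 0 < 1 + e by rewrite ltr_wpDr.
apply: (@le_trans _ _ (ln ((1 + e) ^+ k))).
  by rewrite ler_ln ?posrE ?divr_gt0 ?exprn_gt0// ler_pdivrMr.
by rewrite lnXn// mulr_natl; apply: ler_wMn2r; rewrite le_ln1Dx// (lt_le_trans _ e0)// ltrN10.
Qed.

End RelativeEntropy.

(** * Averages over a finite set and Bernoulli laws *)

Section UniformLaws.
Variables (R : realType) (T : finType) (A : {set T}).

Definition mean (g : T -> R) : R := #|A|%:R^-1 * \sum_(w in A) g w.

Lemma meanD f g : mean (fun w => f w + g w) = mean f + mean g.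
Proof. by rewrite /mean big_split mulrDr. Qed.

Lemma meanZ a f : mean (fun w => a * f w) = a * mean f.
Proof. by rewrite /mean -mulr_sumr mulrCA. Qed.

Lemma mean_sum (I : finType) (P : pred I) (f : I -> T -> R) :
  mean (fun w => \sum_(i | P i) f i w) = \sum_(i | P i) mean (f i).
Proof. by rewrite /mean exchange_big mulr_sumr. Qed.

Lemma eq_mean f g : (forall w, w \in A -> f w = g w) -> mean f = mean g.
Proof. by move=> fg; rewrite /mean; congr (_ * _); exact: eq_bigr. Qed.

Lemma le_mean f g : (forall w, w \in A -> f w <= g w) -> mean f <= mean g.
Proof. by move=> fg; rewrite ler_wpM2l ?invr_ge0//; exact: ler_sum. Qed.

Lemma mean_ge0 f : (forall w, w \in A -> 0 <= f w) -> 0 <= mean f.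
Proof. by move=> f0; rewrite mulr_ge0 ?invr_ge0//; exact: sumr_ge0. Qed.

Lemma exchange_mean (f : T -> T -> R) :
  mean (fun w => mean (f w)) = mean (fun w' => mean (fun w => f w w')).
Proof.
rewrite /mean; under eq_bigr do rewrite mulr_sumr.
rewrite exchange_big/=; congr (_ * _).
by apply: eq_bigr => w _; rewrite mulr_sumr.
Qed.

Lemma sum_law (U : finType) (Y : T -> U) (g : U -> R) :
  \sum_x law (uniform_pmf R A) Y x * g x = mean (fun w => g (Y w)).
Proof.
rewrite /mean mulr_sumr (partition_big Y predT)//=; apply: eq_bigr => x _.
rewrite /law mulr_suml big_mkcond [RHS]big_mkcond/=.
by apply: eq_bigr => w _; rewrite /uniform_pmf; case: (w \in A); case: eqP => [->|]//=; rewrite mul0r.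
Qed.

Lemma law_mean (U : finType) (Y : T -> U) x :
  law (uniform_pmf R A) Y x = mean (fun w => (Y w == x)%:R).
Proof.
rewrite -(@sum_law _ Y (fun y => (y == x)%:R)) (bigD1 x)//= eqxx mulr1 big1 ?addr0// => y /negPf ->.
by rewrite mulr0.
Qed.

Lemma law_ge0 (U : finType) (Y : T -> U) x : 0 <= law (uniform_pmf R A) Y x.
Proof. by rewrite law_mean; exact: mean_ge0. Qed.

Hypothesis A_gt0 : (0 < #|A|)%N.

Lemma card_gt0R : 0 < #|A|%:R :> R.
Proof. by rewrite ltr0n. Qed.

Lemma mean_cst a : mean (fun=> a) = a.
Proof.
by rewrite /mean sumr_const -[a *+ _]mulr_natl mulrA mulVf ?mul1r// gt_eqF// card_gt0R.
Qed.

Lemma mean_gt0 f w0 : w0 \in A -> (forall w, w \in A -> 0 <= f w) -> 0 < f w0 ->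
  0 < mean f.
Proof.
move=> w0A f0 fw0; rewrite mulr_gt0 ?invr_gt0 ?card_gt0R//.
rewrite (bigD1 w0)//= ltr_wpDr//.
by apply: sumr_ge0 => w /andP[wA _]; exact: f0.
Qed.

Lemma law_total (U : finType) (Y : T -> U) : \sum_x law (uniform_pmf R A) Y x = 1.
Proof.
under eq_bigr do rewrite -[law _ _ _]mulr1.
by rewrite (sum_law Y (fun=> 1)) mean_cst.
Qed.

Lemma relative_entropy_law (U : finType) (Y : T -> U) (q : U -> R) :
  relative_entropy (law (uniform_pmf R A) Y) q =
  mean (fun w => ln (law (uniform_pmf R A) Y (Y w) / q (Y w))).
Proof.
by rewrite /relative_entropy (sum_law Y (fun x => ln (law (uniform_pmf R A) Y x / q x))).
Qed.

End UniformLaws.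

Section BernoulliLaws.
Variable R : realType.
Implicit Types p : R.

Lemma bernoulli_pmf_gt0 p b : 0 < p < 1 -> 0 < bernoulli_pmf p b.
Proof. by case/andP => p0 p1; case: b; rewrite /= ?subr_gt0. Qed.

Lemma sum_bernoulli_pmf p : \sum_b bernoulli_pmf p b = 1.
Proof. by rewrite big_bool /= addrC subrK. Qed.

Lemma iid_bernoulli_gt0 k p x : 0 < p < 1 -> 0 < iid_bernoulli k p x.
Proof. by move=> p01; apply: prodr_gt0 => i _; exact: bernoulli_pmf_gt0. Qed.

Lemma iid_bernoulli_total k p : \sum_x iid_bernoulli k p x = 1.
Proof.
rewrite /iid_bernoulli -(bigA_distr_bigA (fun (_ : 'I_k) b => bernoulli_pmf p b)).
by rewrite big1// => i _; exact: sum_bernoulli_pmf.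
Qed.

Lemma dTV_uniform_iid (T : finType) (A : {set T}) k (Y : T -> {ffun 'I_k -> bool}) p :
  (0 < #|A|)%N -> 0 < p < 1 ->
  dTV (law (uniform_pmf R A) Y) (iid_bernoulli k p) ^+ 2 <=
  relative_entropy (law (uniform_pmf R A) Y) (iid_bernoulli k p).
Proof.
move=> A0 p01; apply: dTV_relative_entropy.
- by move=> x; exact: law_ge0.
- by move=> x; exact: iid_bernoulli_gt0.
- exact: law_total.
- exact: iid_bernoulli_total.
Qed.

End BernoulliLaws.

Section Exchangeable.
Variables (R : realType) (T : finType) (A : {set T}) (n : nat).
Variables (X : 'I_n -> T -> bool) (C b : R).
Hypothesis A_gt0 : (0 < #|A|)%N.
Hypothesis C01 : 0 < C < 1.
Hypothesis exch : forall (i j : 'I_n) (f : ('I_n -> bool) -> R),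
  mean A (fun w => f (X ^~ w)) = mean A (fun w => f (fun l => X (tperm i j l) w)).
Hypothesis sumX : forall w, w \in A -> `|\sum_l (X l w)%:R - C * n%:R| <= b.

Local Notation E := (mean A).
Let xi (l : 'I_n) (w : T) : R := (X l w)%:R - C.

Let norm_xi l w : `|xi l w| <= 1.
Proof.
case/andP: C01 => C0 C1; rewrite /xi ler_norml; case: (X l w) => /=; lra.
Qed.

Let sqr_xi l w : xi l w ^+ 2 <= 1.
Proof. by rewrite -[_ ^+ 2]real_normK ?num_real// expr_le1// normr_ge0. Qed.

Let b_ge0 : 0 <= b.
Proof. by case/card_gt0P: A_gt0 => w /sumX; exact: le_trans. Qed.

Let norm_sum_xi w : w \in A -> `|\sum_l xi l w| <= b.
Proof.
by move=> wA; rewrite sumrB sumr_const card_ord -[C *+ n]mulr_natr; exact: sumX.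
Qed.

(** The correlation of two distinct variables does not depend on the second one,
    hence is the average over it; the almost deterministic sum makes that
    average small. *)
Let correlation i j : i != j -> E (fun w => xi i w * xi j w) <= b / n.-1%:R.
Proof.
move=> ij.
have n1 : (0 < n.-1)%N.
  by case: n i j ij => [[]//|[|]//] i j; rewrite !ord1.
rewrite ler_pdivlMr ?ltr0n//.
have same j' : j' != i -> E (fun w => xi i w * xi j' w) = E (fun w => xi i w * xi j w).
  move=> j'i.
  rewrite (exch j j' (fun v => ((v i)%:R - C) * ((v j')%:R - C))).
  by apply: eq_mean => w _; rewrite tpermR tpermD// eq_sym.
have : \sum_(j' | j' != i) E (fun w => xi i w * xi j' w) <= b.
  rewrite -mean_sum -[leRHS](mean_cst A_gt0); apply: le_mean => w wA.
  have -> : \sum_(j' | j' != i) xi i w * xi j' w =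
            xi i w * (\sum_l xi l w) - xi i w ^+ 2.
    by rewrite [\sum_l xi l w](bigD1 i)//= -mulr_sumr; ring.
  have := sqr_ge0 (xi i w).
  have : xi i w * \sum_l xi l w <= b.
    apply: le_trans (ler_norm _) _; rewrite normrM.
    by rewrite -[leRHS]mul1r ler_pM// norm_sum_xi.
  lra.
rewrite (eq_bigr _ same) sumr_const (_ : #|_| = n.-1); first by rewrite -[_ *+ _]mulr_natr.
have := cardC1 i; rewrite card_ord => <-; exact: eq_card.
Qed.

Let tail (t : nat) (w : T) : R := (\sum_(l < n | (t <= l)%N) xi l w) / (n - t)%:R.

Let card_tail t : (t < n)%N -> #|[pred l : 'I_n | (t <= l)%N]| = (n - t)%N.
Proof.
move=> tn; rewrite -sum1_card big_mkcond/=.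
rewrite -(big_mkord predT (fun l => if (t <= l)%N then 1%N else 0%N))/=.
rewrite (big_cat_nat (n := t))//=; last exact: ltnW.
rewrite big_nat_cond big1 ?add0n; last by move=> i; rewrite andbT => /andP[_]; rewrite ltnNge => /negPf ->.
rewrite big_nat_cond (eq_bigr (fun=> 1%N)); last by move=> i; rewrite andbT => /andP[->].
by rewrite -big_nat_cond sum_nat_const_nat muln1.
Qed.

Let mean_sqr_tail t : (t < n)%N ->
  E (fun w => tail t w ^+ 2) <= (n - t)%:R^-1 + b / n.-1%:R.
Proof.
move=> tn; have nt : 0 < (n - t)%:R :> R by rewrite ltr0n subn_gt0.
have -> : E (fun w => tail t w ^+ 2) =
    ((n - t)%:R ^- 2) * \sum_(i < n | (t <= i)%N) \sum_(j < n | (t <= j)%N)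
       E (fun w => xi i w * xi j w).
  under eq_bigr do rewrite -mean_sum.
  rewrite -mean_sum -meanZ; apply: eq_mean => w _.
  rewrite /tail exprMn -exprVn mulrC; congr (_ * _).
  by rewrite expr2 mulr_suml; apply: eq_bigr => i _; rewrite mulr_sumr.
rewrite mulrC ler_pdivrMr ?exprn_gt0//.
set B := b / _; have B0 : 0 <= B by rewrite divr_ge0.
have -> : ((n - t)%:R^-1 + B) * (n - t)%:R ^+ 2 =
   \sum_(i < n | (t <= i)%N) (1 + (n - t)%:R * B).
  rewrite sumr_const card_tail// -[_ *+ _]mulr_natr; field; by rewrite gt_eqF.
apply: ler_sum => i ti; rewrite (bigD1 i)//= lerD//.
  by rewrite -[leRHS](mean_cst A_gt0); apply: le_mean => w _; rewrite -expr2.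
apply: (@le_trans _ _ (\sum_(j < n | (t <= j)%N && (j != i)) B)).
  by apply: ler_sum => j /andP[_ ji]; rewrite correlation// eq_sym.
apply: (@le_trans _ _ (\sum_(j < n | (t <= j)%N) B)).
  rewrite [leRHS](bigD1 i)//= lerDr//.
by rewrite sumr_const card_tail// -[_ *+ _]mulr_natl.
Qed.

(** [D t] is the relative entropy of the first [t] variables, written as an
    average over the sample space: the laws for different [t] live on different
    sets, but these averages can be subtracted term by term. *)
Let agree (t : nat) (v v' : 'I_n -> bool) : bool :=
  [forall l : 'I_n, (l < t)%N ==> (v l == v' l)].

Let P t (v : 'I_n -> bool) : R := E (fun w => (agree t v (X ^~ w))%:R).
Let Q t (v : 'I_n -> bool) : R := \prod_(l < n | (l < t)%N) bernoulli_pmf C (v l).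
Let D t : R := E (fun w => ln (P t (X ^~ w) / Q t (X ^~ w))).

Let agree_refl t v : agree t v v.
Proof. by apply/forallP => l; apply/implyP. Qed.

Let agree_sym t v v' : agree t v v' = agree t v' v.
Proof. by apply: eq_forallb => l; rewrite eq_sym. Qed.

Let agree_trans t v v' v'' : agree t v v' -> agree t v v'' = agree t v' v''.
Proof.
move=> /forallP vv'; apply: eq_forallb => l; case: (boolP (l < t)%N) => //= lt.
by have /implyP/(_ lt)/eqP -> := vv' l.
Qed.

Let P_gt0 t w : w \in A -> 0 < P t (X ^~ w).
Proof.
by move=> wA; apply: (mean_gt0 A_gt0 wA) => //; rewrite agree_refl.
Qed.

Let Q_gt0 t v : 0 < Q t v.
Proof. by apply: prodr_gt0 => i _; exact: bernoulli_pmf_gt0. Qed.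

(** A function of the first [t] variables has the same correlation with each
    later variable, hence with their average. *)
Let tail_average t (tn : (t < n)%N) (H : ('I_n -> bool) -> R) :
  (forall v v', agree t v v' -> H v = H v') ->
  E (fun w => xi (Ordinal tn) w * H (X ^~ w)) = E (fun w => tail t w * H (X ^~ w)).
Proof.
move=> HH; set o := Ordinal tn.
have nt : (n - t)%:R != 0 :> R by rewrite pnatr_eq0 -lt0n subn_gt0.
have same (l : 'I_n) : (t <= l)%N -> E (fun w => xi l w * H (X ^~ w)) = E (fun w => xi o w * H (X ^~ w)).
  move=> tl; rewrite (exch o l (fun v => ((v l)%:R - C) * H v)).
  apply: eq_mean => w _; rewrite tpermR; congr (_ * _); apply: HH.
  apply/forallP => j; apply/implyP => jt; rewrite tpermD// -val_eqE/= neq_ltn.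
    by rewrite jt orbT.
  by rewrite (leq_trans jt tl) orbT.
transitivity ((n - t)%:R^-1 * \sum_(l < n | (t <= l)%N) E (fun w => xi l w * H (X ^~ w))).
  by rewrite (eq_bigr _ same) sumr_const card_tail// -[X in _ * X]mulr_natl mulrA mulVf// mul1r.
rewrite -mean_sum -meanZ; apply: eq_mean => w _.
by rewrite -mulr_suml /tail mulrA; congr (_ * _); rewrite mulrC.
Qed.

(** One step of the chain rule for relative entropy.  Since [ln x <= x - 1], the
    increment is at most the chi-square distance of the conditional law of the
    next variable to its Bernoulli law; exchangeability replaces that variable
    by the average of all the remaining ones, whose variance is small. *)
Let entropy_step t : (t < n)%N ->
  D t.+1 - D t <= ((n - t)%:R^-1 + b / n.-1%:R) / (C * (1 - C)).
Proof.
move=> tn; set o := Ordinal tn.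
have /andP[C0 C1] := C01.
have CC : 0 < C * (1 - C) by rewrite mulr_gt0// subr_gt0.
pose Psi v : R := E (fun w => (agree t v (X ^~ w))%:R * xi o w).
have PsiE v : Psi v = E (fun w => (agree t v (X ^~ w))%:R * tail t w).
  have := @tail_average t tn (fun u => (agree t v u)%:R).
  rewrite -/o /Psi => H.
  under eq_mean => w _ do rewrite mulrC.
  rewrite H; first by apply: eq_mean => w _; rewrite mulrC.
  by move=> u u' uu'; rewrite agree_sym [agree t v u']agree_sym (agree_trans _ uu').
have agreeS v v' : agree t.+1 v v' = agree t v v' && (v o == v' o).
  apply/idP/andP => [/forallP H|[/forallP H /eqP ho]].
    split; last by have := H o; rewrite /= ltnSn.
    by apply/forallP => l; apply/implyP => lt; have /implyP := H l; apply; apply: ltnW.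
  apply/forallP => l; apply/implyP; rewrite ltnS leq_eqVlt => /orP[/eqP lt|lt].
    by have -> : l = o; [exact: val_inj|rewrite ho].
  by have /implyP := H l; apply.
have PS v : P t.+1 v - P t v * bernoulli_pmf C (v o) = (if v o then 1 else -1) * Psi v.
  rewrite [P t v * _]mulrC -mulNr /Psi /P -!meanZ -meanD; apply: eq_mean => w _.
  rewrite agreeS /xi; case: (agree _ _ _); case: (v o); case: (X o w) => /=; ring.
have step w : w \in A ->
    ln (P t.+1 (X ^~ w) / Q t.+1 (X ^~ w)) - ln (P t (X ^~ w) / Q t (X ^~ w)) <=
    (C * (1 - C))^-1 * (xi o w * (Psi (X ^~ w) / P t (X ^~ w))).
  move=> wA; set v := X ^~ w.
  have P0 := P_gt0 t wA; have P1 := P_gt0 t.+1 wA; rewrite -/v in P0 P1.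
  have B0 := bernoulli_pmf_gt0 (v o) C01.
  have QS : Q t.+1 v = Q t v * bernoulli_pmf C (v o).
    rewrite /Q (bigD1 o)//= mulrC; congr (_ * _); apply: eq_bigl => l.
    by rewrite ltnS leq_eqVlt -val_eqE/=; case: (ltngtP l t).
  have Q0 := Q_gt0 t v.
  rewrite QS -ln_div ?posrE ?divr_gt0// ?mulr_gt0//.
  have -> : P t.+1 v / (Q t v * bernoulli_pmf C (v o)) / (P t v / Q t v) =
            1 + (P t.+1 v - P t v * bernoulli_pmf C (v o)) / (P t v * bernoulli_pmf C (v o)).
    by field; rewrite !gt_eqF.
  have -> : (C * (1 - C))^-1 * (xi o w * (Psi v / P t v)) =
            (P t.+1 v - P t v * bernoulli_pmf C (v o)) / (P t v * bernoulli_pmf C (v o)).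
    rewrite PS /xi -/(v o); move: B0; case: (v o) => /= B0; field; rewrite ?gt_eqF// ?subr_gt0//.
  by apply: le_ln1Dx; rewrite (ltr_pdivlMr _ _ (mulr_gt0 P0 B0)) mulN1r ltrBrDr addNr.
have -> : D t.+1 - D t = E (fun w => ln (P t.+1 (X ^~ w) / Q t.+1 (X ^~ w)) -
                                 ln (P t (X ^~ w) / Q t (X ^~ w))).
  by rewrite /D -mulN1r -meanZ -meanD; apply: eq_mean => w _; rewrite mulN1r.
apply: (le_trans (le_mean step)).
rewrite meanZ mulrC; apply: ler_wpM2r; first by rewrite invr_ge0 ltW.
apply: (le_trans _ (mean_sqr_tail tn)).
have Pagree v v' : agree t v v' -> P t v = P t v'.
  by move=> vv'; apply: eq_mean => w _; rewrite (agree_trans _ vv').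
rewrite (@tail_average t tn (fun v => Psi v / P t v)); last first.
  move=> v v' vv'; rewrite (Pagree _ _ vv'); congr (_ / _).
  by apply: eq_mean => w _; rewrite (agree_trans _ vv').
have -> : E (fun w => tail t w * (Psi (X^~ w) / P t (X^~ w))) =
   E (fun w => E (fun w' => (agree t (X ^~ w) (X ^~ w'))%:R / P t (X ^~ w) *
                 (tail t w * tail t w'))).
  apply: eq_mean => w _; rewrite PsiE (_ : tail t w * _ = (tail t w / P t (X ^~ w)) *
    E (fun w' => (agree t (X ^~ w) (X ^~ w'))%:R * tail t w')); last by ring.
  rewrite -meanZ.
  by apply: eq_mean => w' _; ring.
pose F w w' := (agree t (X ^~ w) (X ^~ w'))%:R / P t (X ^~ w) * (tail t w ^+ 2 / 2).
have Fsum : E (fun w => E (F w)) = E (fun w => tail t w ^+ 2) / 2.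
  rewrite [RHS]mulrC -meanZ; apply: eq_mean => w wA; rewrite /F.
  transitivity (P t (X ^~ w) / P t (X ^~ w) * (tail t w ^+ 2 / 2)).
    rewrite (_ : _ * (_ / 2) = (tail t w ^+ 2 / 2 / P t (X ^~ w)) * P t (X ^~ w)); last by ring.
    rewrite -meanZ; by apply: eq_mean => w' _; ring.
  by rewrite divff ?mul1r 1?mulrC// gt_eqF// P_gt0.
have -> : E (fun w => tail t w ^+ 2) = E (fun w => E (F w)) + E (fun w => E (fun w' => F w' w)).
  by rewrite [X in _ + X]exchange_mean Fsum; field.
rewrite -meanD; apply: le_mean => w wA; rewrite -meanD; apply: le_mean => w' w'A.
rewrite /F [agree _ (X ^~ w') _]agree_sym; case: (boolP (agree _ _ _)) => [vv'|_]; last by rewrite !mul0r addr0.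
rewrite (Pagree _ _ vv') -mulrDr; apply: ler_wpM2l.
  by rewrite divr_ge0// ltW// P_gt0.
by have := sqr_ge0 (tail t w - tail t w'); nra.
Qed.

Lemma relative_entropy_exchangeable k (kn : (k <= n)%N) (Y : T -> {ffun 'I_k -> bool}) :
  (forall w t, Y w t = X (widen_ord kn t) w) ->
  relative_entropy (law (uniform_pmf R A) Y) (iid_bernoulli k C) <=
  \sum_(t < k) ((n - t)%:R^-1 + b / n.-1%:R) / (C * (1 - C)).
Proof.
move=> YX.
have -> : relative_entropy (law (uniform_pmf R A) Y) (iid_bernoulli k C) = D k.
  rewrite relative_entropy_law; apply: eq_mean => w _; congr (ln (_ / _)).
    rewrite law_mean; apply: eq_mean => w' _; congr (nat_of_bool _)%:R.
    apply/eqP/forallP => [YY l|H].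
      apply/implyP => lk; have := YX w (Ordinal lk); have := YX w' (Ordinal lk).
      by rewrite YY => -> /eqP; rewrite (_ : widen_ord _ _ = l)//; first rewrite eq_sym //; exact: val_inj.
    by apply/ffunP => t; rewrite !YX; have /implyP/(_ (ltn_ord t))/eqP := H (widen_ord kn t).
  rewrite /iid_bernoulli /Q big_ord_narrow.
  by apply: eq_bigr => t _; rewrite YX.
have {YX Y} D0 : D 0 = 0.
  rewrite -[RHS](mean_cst A_gt0); apply: eq_mean => w _.
  rewrite /Q big1// divr1 /P (_ : mean _ _ = 1) ?ln1// -[RHS](mean_cst A_gt0).
  by apply: eq_mean => w' _; rewrite (_ : agree _ _ _)//; apply/forallP.
elim: k kn => [|k IH] kn; first by rewrite D0 big_ord0.
by rewrite big_ord_recr/= -[D k.+1](subrK (D k)) addrC lerD ?IH ?entropy_step// ltnW.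
Qed.

End Exchangeable.

(** * Balancing the margins *)

Section Balancing.
Variables (m l : nat).
Implicit Types (r : 'I_m -> nat) (c : 'I_l -> nat) (M : 'M[bool]_(m, l)).

Lemma binary_tablesP r c M :
  reflect ((forall i, (\sum_j M i j)%N = r i) /\ (forall j, (\sum_i M i j)%N = c j))
          (M \in binary_tables r c).
Proof.
rewrite inE; apply: (iffP andP) => [[/forallP Hr /forallP Hc]|[Hr Hc]].
  by split=> i; apply/eqP.
by split; apply/forallP => i; apply/eqP.
Qed.

(** Join a table of the first kind to the tables of the second kind obtained by
    exchanging the rows [i1] and [i2] in one column that has a 1 above a 0, and
    give each edge the inverse of the degree of its first end.  A table of the
    first kind then gives 1 in total.  A table of the second kind receives at
    most 1: its degree is at most its number of 0-over-1 columns, which is at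
    most the number of 1-over-0 columns of each of its neighbours, because the
    neighbour has the larger sum in row [i1]. *)
Lemma card_tables_transfer r r' c (i1 i2 : 'I_m) : i1 != i2 -> (r i2 < r i1)%N ->
  r' i1 = (r i1).-1 -> r' i2 = (r i2).+1 ->
  (forall i, i != i1 -> i != i2 -> r' i = r i) ->
  (#|binary_tables r c| <= #|binary_tables r' c|)%N.
Proof.
move=> i12 r21 r'1 r'2 r'E.
set A := binary_tables r c; set A' := binary_tables r' c.
pose swap (j : 'I_l) M : 'M[bool]_(m, l) :=
  \matrix_(i, j') if j' == j then M (tperm i1 i2 i) j' else M i j'.
pose down (j : 'I_l) M := M i1 j && ~~ M i2 j.
pose up (j : 'I_l) M := ~~ M i1 j && M i2 j.
pose u M := (\sum_j down j M)%N; pose v M := (\sum_j up j M)%N.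
have swapK j : involutive (swap j).
  move=> M; apply/matrixP => i j'; rewrite !mxE; case: eqP => // ->.
  by rewrite tpermK.
have uv M : M \in A -> (r i1 + v M = r i2 + u M)%N.
  move=> /binary_tablesP[Hr _]; rewrite -!Hr /u /v -!big_split/=.
  by apply: eq_bigr => j _; rewrite /up /down; case: (M i1 j); case: (M i2 j).
have downup j M : down j M -> up j (swap j M).
  by rewrite /down /up !mxE eqxx tpermL tpermR andbC.
have swap_A' j M : M \in A -> down j M -> swap j M \in A'.
  move=> /binary_tablesP[Hr Hc] /andP[M1 M2].
  have E1 : (\sum_j' swap j M i1 j').+1 = r i1.
    rewrite -Hr (bigD1 j)//= [in RHS](bigD1 j)//= !mxE eqxx tpermL (negPf M2) M1 add0n add1n.
    by congr _.+1; apply: eq_bigr => j' /negPf jj; rewrite mxE jj.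
  have E2 : (\sum_j' swap j M i2 j')%N = (r i2).+1.
    rewrite -Hr (bigD1 j)//= [in RHS](bigD1 j)//= !mxE eqxx tpermR (negPf M2) M1 add0n add1n.
    by congr _.+1; apply: eq_bigr => j' /negPf jj; rewrite mxE jj.
  apply/binary_tablesP; split=> [i|j'].
    have [->|n1] := eqVneq i i1; first by rewrite r'1 -E1.
    have [->|n2] := eqVneq i i2; first by rewrite r'2 -E2.
    rewrite r'E// -Hr; apply: eq_bigr => j' _; rewrite mxE tpermD 1?eq_sym//.
    by case: ifP.
  rewrite -Hc (reindex_inj (@perm_inj _ (tperm i1 i2)))/=.
  have [->|jj] := eqVneq j' j.
    by apply: eq_bigr => i _; rewrite mxE eqxx tpermK.
  rewrite [RHS](reindex_inj (@perm_inj _ (tperm i1 i2)))/=.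
  by apply: eq_bigr => i _; rewrite mxE (negPf jj).
have v_swap j M : M \in A -> down j M -> (v (swap j M) <= u M)%N.
  move=> MA d; have := uv _ MA.
  suff -> : v (swap j M) = (v M).+1 by lia.
  have dj : up j M = false by move: d; rewrite /down /up => /andP[->].
  rewrite /v (bigD1 j)//= (downup _ _ d) [in RHS](bigD1 j)//= dj add1n.
  by congr _.+1; apply: eq_bigr => j' /negPf jj; rewrite /up !mxE jj.
have sum_down M : M \in A -> \sum_(j | down j M) ((u M)%:R^-1 : rat) = 1.
  move=> MA; have u0 : (0 < u M)%N by have := uv _ MA; lia.
  rewrite sumr_const -sum1_card big_mkcond/= -[X in _ *+ X]/(u M) -[_ *+ _]mulr_natl mulfV//.
  by rewrite pnatr_eq0 -lt0n.
have sum_up M : \sum_(j | up j M) ((v M)%:R^-1 : rat) <= 1.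
  rewrite sumr_const -sum1_card big_mkcond/= -[X in _ *+ X]/(v M) -[_ *+ _]mulr_natl.
  by case: (v M) => [|k]; rewrite ?mul0r// mulfV// pnatr_eq0.
rewrite -(ler_nat rat) -[#|A|]sum1_card -[#|A'|]sum1_card !natr_sum.
rewrite -(eq_bigr _ sum_down).
apply: le_trans (ler_sum _ (fun M _ => sum_up M)).
rewrite [leLHS](exchange_big_dep predT)//= [leRHS](exchange_big_dep predT)//=.
apply: ler_sum => j _.
rewrite [leRHS](reindex_inj (inv_inj (swapK j)))/=.
rewrite [leLHS]big_mkcond [leRHS]big_mkcond/=; apply: ler_sum => M _.
case: ifP => [/andP[MA d]|_].
  rewrite swap_A'// downup//= lef_pV2 ?posrE ?ltr0n ?ler_nat.
  - exact: v_swap.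
  - by have := uv _ MA; lia.
  by rewrite /v (bigD1 j)//= downup.
by case: ifP.
Qed.

Lemma eq_binary_tables r r' c c' : r =1 r' -> c =1 c' ->
  binary_tables r c = binary_tables r' c'.
Proof.
move=> rr' cc'; apply/setP => M; rewrite !inE; congr andb.
  by apply: eq_forallb => i; rewrite rr'.
by apply: eq_forallb => i; rewrite cc'.
Qed.

(** As long as the row sums of some class are not all equal to their average,
    one of them is above it and another one below.  Transfers between such rows
    decrease the distance to the constant row sums. *)
Lemma card_tables_balance (K : eqType) (g : 'I_m -> K) (t : K -> nat) r c :
  (forall a, \sum_(i | g i == a) r i = \sum_(i | g i == a) t a)%N ->
  (#|binary_tables r c| <= #|binary_tables (t \o g) c|)%N.
Proof.
pose dist r := (\sum_i (r i - t (g i) + (t (g i) - r i)))%N.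
have [N] := ubnP (dist r); elim: N r => // N IH r; rewrite ltnS => rN rt.
have [/existsP[i0 ri0]|/existsPn req] := boolP [exists i, r i != t (g i)]; last first.
  rewrite (_ : binary_tables r c = binary_tables (t \o g) c) ?leqnn//.
  by apply: eq_binary_tables => // i; apply/eqP; rewrite -[_ == _]negbK.
have [i1 [i2 [g12 r1 r2]]] : exists i1 i2, [/\ g i1 = g i2, t (g i1) < r i1 & r i2 < t (g i2)]%N.
  have := rt (g i0); rewrite (bigD1 i0)//= [in RHS](bigD1 i0)//= => S.
  have [lt|gt] : (r i0 < t (g i0) \/ t (g i0) < r i0)%N by move: ri0; rewrite neq_ltn => /orP.
    have [/existsP[i1 /andP[/eqP g1 r1]]|/existsPn H] := boolP [exists i, (g i == g i0) && (t (g i) < r i)%N].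
      by exists i1, i0.
    suff : (\sum_(i | (g i == g i0) && (i != i0)) r i <= \sum_(i | (g i == g i0) && (i != i0)) t (g i0))%N.
      by move=> le; have := leq_add lt le; rewrite addSn S ltnn.
    by apply: leq_sum => i /andP[/eqP gi _]; have := H i; rewrite gi eqxx -leqNgt.
  have [/existsP[i1 /andP[/eqP g1 r1]]|/existsPn H] := boolP [exists i, (g i == g i0) && (r i < t (g i))%N].
    by exists i0, i1.
  suff : (\sum_(i | (g i == g i0) && (i != i0)) t (g i0) <= \sum_(i | (g i == g i0) && (i != i0)) r i)%N.
    by move=> le; have := leq_add gt le; rewrite addSn S ltnn.
  by apply: leq_sum => i /andP[/eqP gi _]; have := H i; rewrite gi eqxx -leqNgt.
have i12 : i1 != i2 by apply/eqP => e; move: r1 r2; rewrite e; lia.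
pose r' i := (if i == i1 then (r i1).-1 else if i == i2 then (r i2).+1 else r i).
have r'1 : r' i1 = (r i1).-1 by rewrite /r' eqxx.
have r'2 : r' i2 = (r i2).+1 by rewrite /r' eq_sym (negPf i12) eqxx.
have r'E i : i != i1 -> i != i2 -> r' i = r i by rewrite /r' => /negPf -> /negPf ->.
apply: leq_trans (card_tables_transfer c i12 _ r'1 r'2 r'E) _; first by move: r1 r2; rewrite g12; lia.
apply: IH => [|a].
  apply: leq_trans rN; rewrite /dist (bigD1 i1)// [ltnRHS](bigD1 i1)//=.
  rewrite (bigD1 i2) 1?eq_sym//= [in ltnRHS](bigD1 i2) 1?eq_sym//= r'1 r'2.
  rewrite (eq_bigr (fun i => r i - t (g i) + (t (g i) - r i))%N); first by move: r1 r2; rewrite g12; lia.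
  by move=> i /andP[n1 n2]; rewrite r'E.
rewrite -rt; have [ga|ga] := eqVneq (g i1) a; last first.
  apply: eq_bigr => i /eqP gi; rewrite r'E//; apply: contraNneq ga => e; move: gi; rewrite e -?g12 => ->; exact: eqxx.
have c1 : g i1 == a by apply/eqP.
have c2 : (g i2 == a) && (i2 != i1) by rewrite -g12 c1 eq_sym.
rewrite (bigD1 i1 c1)/= [RHS](bigD1 i1 c1)/= (bigD1 i2 c2)/= [in RHS](bigD1 i2 c2)/= r'1 r'2.
rewrite (eq_bigr r); first by move: r1 r2; lia.
by move=> i /andP[/andP[_ n1] n2]; rewrite r'E.
Qed.

End Balancing.

Lemma card_tables_tr m l (r : 'I_m -> nat) (c : 'I_l -> nat) :
  #|binary_tables r c| = #|binary_tables c r|.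
Proof.
rewrite -(card_imset _ (@trmx_inj _ _ _)); congr #|pred_of_set _|; apply/setP => M.
apply/imsetP/binary_tablesP => [[M' /binary_tablesP[Hr Hc] ->]|[Hr Hc]].
  by split=> i; [rewrite -Hc|rewrite -Hr]; apply: eq_bigr => j _; rewrite mxE.
exists M^T; last by rewrite trmxK.
by apply/binary_tablesP; split=> i; [rewrite -Hc|rewrite -Hr]; apply: eq_bigr => j _; rewrite mxE.
Qed.

Section BlockTotals.
Variables (m l : nat) (K : eqType) (g : 'I_m -> K) (h : 'I_l -> K).

(** Only the totals of the margins over the classes are prescribed: this is all
    that the mass of a matrix sees, under a product measure whose odds are
    products of a factor of the row class and a factor of the column class. *)
Definition block_tables (t s : K -> nat) (M : 'M[bool]_(m, l)) : Prop :=
  (forall a, \sum_(i | g i == a) \sum_j M i j = \sum_(i | g i == a) t a)%N /\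
  (forall a, \sum_(j | h j == a) \sum_i M i j = \sum_(j | h j == a) s a)%N.

(** Pigeonhole over the margins, none of which carries more tables than the
    constant ones. *)
Lemma card_block_tables (t s : K -> nat) (S : {set 'M[bool]_(m, l)}) :
  (forall M, M \in S -> block_tables t s M) ->
  (#|S| <= l.+1 ^ m * m.+1 ^ l * #|binary_tables (t \o g) (s \o h)|)%N.
Proof.
move=> SH.
have sum_le n (f : 'I_n -> bool) : (\sum_j f j < n.+1)%N.
  rewrite ltnS -[leqRHS]card_ord -sum1_card; apply: leq_sum => j _; exact: leq_b1.
pose F (M : 'M[bool]_(m, l)) : {ffun 'I_m -> 'I_l.+1} * {ffun 'I_l -> 'I_m.+1} :=
  ([ffun i => Ordinal (sum_le _ (fun j => M i j))], [ffun j => Ordinal (sum_le _ (fun i => M i j))]).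
rewrite -sum1_card (partition_big F predT)//=.
apply: (@leq_trans (\sum_(p : {ffun 'I_m -> 'I_l.+1} * {ffun 'I_l -> 'I_m.+1})
    #|binary_tables (t \o g) (s \o h)|)); last first.
  by rewrite sum_nat_const card_prod !card_ffun !card_ord.
apply: leq_sum => p _.
have [/existsP[M0 /andP[M0S /eqP FM0]]|/existsPn noM] :=
    boolP [exists M, (M \in S) && (F M == p)]; last first.
  by rewrite big1// => M MS; have := noM M; rewrite MS.
have [H1 H2] := SH _ M0S.
pose r i := (\sum_j M0 i j)%N; pose c j := (\sum_i M0 i j)%N.
apply: (@leq_trans #|binary_tables r c|).
  rewrite sum1_card; apply: subset_leq_card; apply/fintype.subsetP => M /andP[_ /eqP FM].
  apply/binary_tablesP; split => i.
    by have := congr1 (fun q : {ffun 'I_m -> 'I_l.+1} * {ffun 'I_l -> 'I_m.+1} => nat_of_ord (q.1 i)) (etrans FM (esym FM0)); rewrite /= !ffunE.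
  by have := congr1 (fun q : {ffun 'I_m -> 'I_l.+1} * {ffun 'I_l -> 'I_m.+1} => nat_of_ord (q.2 i)) (etrans FM (esym FM0)); rewrite /= !ffunE.
apply: leq_trans (card_tables_balance _ H1) _.
rewrite card_tables_tr [leqRHS]card_tables_tr.
exact: (card_tables_balance _ H2).
Qed.

End BlockTotals.

(** * Product measures on 0-1 matrices *)

Section ProductMeasure.
Variables (R : realType) (m l : nat).
Local Notation U := ('I_m * 'I_l)%type.
Local Notation mat := 'M[bool]_(m, l).
Implicit Types (M : mat) (u : U) (E : {set U}).

Definition product_pmf (w : U -> bool -> R) M : R := \prod_u w u (M u.1 u.2).

Lemma sum_product_pmf w : \sum_M product_pmf w M = \prod_u \sum_b w u b.
Proof.
rewrite bigA_distr_bigA (reindex (fun f : {ffun U -> bool} => \matrix_(i, j) f (i, j)))/=.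
  by apply: eq_bigr => f _; apply: eq_bigr => -[i j] _; rewrite mxE.
exists (fun M : mat => [ffun u => M u.1 u.2]) => [f _|M _].
  by apply/ffunP => -[i j]; rewrite ffunE mxE.
by apply/matrixP => i j; rewrite mxE ffunE.
Qed.

Variable w : U -> bool -> R.
Hypothesis sum_w : forall u, \sum_b w u b = 1.
Local Notation W := (product_pmf w).

Definition expect (f : mat -> R) : R := \sum_M W M * f M.

Lemma expect_total : expect (fun=> 1) = 1.
Proof.
rewrite /expect; under eq_bigr do rewrite mulr1.
by rewrite sum_product_pmf big1.
Qed.

Lemma expect_cylinder E M0 :
  expect (fun M => [forall u, (u \in E) ==> (M u.1 u.2 == M0 u.1 u.2)]%:R) =
  \prod_(u in E) w u (M0 u.1 u.2).
Proof.
pose w' u b := w u b * ((u \in E) ==> (b == M0 u.1 u.2))%:R.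
transitivity (\sum_M product_pmf w' M).
  apply: eq_bigr => M _; rewrite /product_pmf /w' big_split/=; congr (_ * _).
  case: (boolP [forall u, _]) => [/forallP H|].
    by rewrite big1// => u _; rewrite H.
  by rewrite negb_forall => /existsP[u /negPf H]; rewrite (bigD1 u)//= H mul0r.
rewrite sum_product_pmf [RHS]big_mkcond/=; apply: eq_bigr => u _; rewrite /w'.
case: (u \in E) => /=; last by rewrite -[RHS](sum_w u); apply: eq_bigr => b _; rewrite mulr1.
rewrite (bigD1 (M0 u.1 u.2))//= eqxx mulr1 big1 ?addr0// => b /negPf ->.
by rewrite mulr0.
Qed.

Definition depends_on E (f : mat -> R) : Prop :=
  forall M M', (forall u, u \in E -> M u.1 u.2 = M' u.1 u.2) -> f M = f M'.

(** Take two independent matrices and exchange their entries outside [E]: this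
    preserves their joint law and turns [F M * G M'] into [F M * G M]. *)
Lemma expectM E F G : depends_on E F -> depends_on (~: E) G ->
  expect (fun M => F M * G M) = expect F * expect G.
Proof.
move=> FE GE.
pose mix (q : mat * mat) : mat * mat :=
  (\matrix_(i, j) if (i, j) \in E then q.1 i j else q.2 i j,
   \matrix_(i, j) if (i, j) \in E then q.2 i j else q.1 i j).
have mixK : involutive mix.
  by move=> [M M']; congr pair; apply/matrixP => i j; rewrite !mxE/= ?mxE; case: ((i, j) \in E).
rewrite {2 3}/expect big_distrlr/= pair_big/= (reindex_inj (inv_inj mixK))/=.
transitivity (\sum_(q : mat * mat) W q.1 * W q.2 * (F q.1 * G q.1)); last first.
  apply: eq_bigr => -[M M'] _; rewrite [RHS]mulrACA; congr (_ * (_ * _)).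
  - rewrite /product_pmf -!big_split/=; apply: eq_bigr => -[i j] _.
    by rewrite !mxE/=; case: ifP => // _; rewrite mulrC.
  - by apply: FE => -[i j] ijE; rewrite mxE/= ijE.
  - by apply: GE => -[i j]; rewrite inE mxE/= => /negPf ->.
rewrite -(pair_bigA _ (fun M M' => W M * W M' * (F M * G M)))/=; apply: eq_bigr => M _.
transitivity (\sum_M' (W M * (F M * G M)) * (W M' * 1)); first by rewrite -mulr_sumr [\sum_M' _]expect_total mulr1.
by apply: eq_bigr => M' _; ring.
Qed.

Lemma expect_prod (I : eqType) (s : seq I) (E : I -> {set U}) (f : I -> mat -> R) :
  uniq s -> (forall i, depends_on (E i) (f i)) ->
  (forall i j u, u \in E i -> u \in E j -> i = j) ->
  expect (fun M => \prod_(i <- s) f i M) = \prod_(i <- s) expect (f i).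
Proof.
move=> + fE Edisj; elim: s => [_|i s IH /=/andP[iNs us]].
  rewrite big_nil -[RHS]expect_total; apply: eq_bigr => M _; by rewrite big_nil.
rewrite big_cons -IH// -(@expectM (E i))//.
  by apply: eq_bigr => M _; rewrite big_cons.
move=> M M' MM'; apply: eq_big_seq => j js; apply: fE => u uE.
apply: MM'; rewrite inE; apply: contraNN iNs => uEi.
by rewrite (Edisj _ _ _ uEi uE).
Qed.

Definition window k (phi : 'I_k -> U) M : {ffun 'I_k -> bool} :=
  [ffun t => M (phi t).1 (phi t).2].

Lemma expect_window k (phi : 'I_k -> U) p f : injective phi ->
  (forall t, w (phi t) =1 bernoulli_pmf p) ->
  expect (fun M => f (window phi M)) = \sum_x iid_bernoulli k p x * f x.
Proof.
move=> phi_inj wphi.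
rewrite /expect (partition_big (window phi) predT)//=; apply: eq_bigr => x _.
pose M0 : mat := \matrix_(i, j) if [pick t | phi t == (i, j)] is Some t then x t else false.
have M0E t : M0 (phi t).1 (phi t).2 = x t.
  rewrite mxE -surjective_pairing; case: pickP => [t' /eqP/phi_inj -> //|/(_ t)].
  by rewrite eqxx.
transitivity (expect (fun M => [forall u, (u \in [set phi t | t in 'I_k]) ==> (M u.1 u.2 == M0 u.1 u.2)]%:R) * f x).
  rewrite /expect mulr_suml big_mkcond/=; apply: eq_bigr => M _.
  rewrite (_ : [forall u, _] = (window phi M == x)).
    by case: eqP => [->|_]; rewrite ?mulr1// mulr0 mul0r.
  apply/forallP/eqP => [H|wx u].
    apply/ffunP => t; rewrite ffunE; have := H (phi t).
    by rewrite imset_f// => /eqP ->; rewrite M0E.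
  apply/implyP => /imsetP[t _ ->]; rewrite mxE -surjective_pairing.
  case: pickP => [t' /eqP/phi_inj ->|/(_ t)]; last by rewrite eqxx.
  by rewrite -wx ffunE.
congr (_ * _); rewrite expect_cylinder big_imset/=; last by move=> ? ? _ _; exact: phi_inj.
by apply: eq_bigr => t _; rewrite M0E wphi.
Qed.

Lemma expect_block_sum E p s : (forall u, u \in E -> w u =1 bernoulli_pmf p) ->
  expect (fun M => ((\sum_(u in E) M u.1 u.2)%N == s)%:R) =
  'C(#|E|, s)%:R * p ^+ s * (1 - p) ^+ (#|E| - s).
Proof.
move=> wE.
pose supp M : {set U} := [set u in E | M u.1 u.2].
have suppE M : (\sum_(u in E) M u.1 u.2)%N = #|supp M|.
  rewrite -sum1_card [RHS]big_mkcond [LHS]big_mkcond/=; apply: eq_bigr => u _.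
  by rewrite inE; case: (u \in E) => //=; case: (M _ _).
pose dr := [set D : {set U} | (D \subset E) && (#|D| == s)].
transitivity (\sum_(D in dr) p ^+ s * (1 - p) ^+ (#|E| - s)); last first.
  by rewrite sumr_const cards_draws -[_ *+ _]mulr_natl mulrA.
transitivity (\sum_(D in dr) expect (fun M => (supp M == D)%:R)).
  rewrite /expect exchange_big/=; apply: eq_bigr => M _; rewrite -mulr_sumr suppE; congr (_ * _).
  case: (boolP (supp M \in dr)) => [sdr|sdr].
    rewrite (bigD1 (supp M))//= eqxx big1 ?addr0.
      by move: sdr; rewrite inE => /andP[_ ->].
    by move=> D /andP[_ /negPf]; rewrite eq_sym => ->.
  rewrite big1 => [|D Ddr]; last by case: eqP sdr => // ->; rewrite Ddr.
  move: sdr; rewrite inE; case: eqP => // _ /negP[]; rewrite andbT.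
  by apply/fintype.subsetP => u; rewrite inE => /andP[].
apply: eq_bigr => D; rewrite inE => /andP[/fintype.subsetP DE /eqP Ds].
pose M0 : mat := \matrix_(i, j) ((i, j) \in D).
have M0E u : M0 u.1 u.2 = (u \in D) by rewrite mxE -surjective_pairing.
transitivity (\prod_(u in E) w u (M0 u.1 u.2)).
  rewrite -expect_cylinder; apply: eq_bigr => M _; congr (_ * (nat_of_bool _)%:R).
  apply/eqP/forallP => [sD u|H].
    by apply/implyP => uE; rewrite M0E -sD inE uE.
  apply/setP => u; rewrite inE; case: (boolP (u \in E)) => uE /=.
    by have := H u; rewrite uE M0E => /eqP.
  by apply/esym/negP => /DE; rewrite (negPf uE).
rewrite (bigID (mem D))/=; congr (_ * _).
  rewrite -Ds -prodr_const; apply: eq_big => [u|u /andP[uE uD]].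
    by rewrite andbC; case: (boolP (u \in D)) => // /DE ->.
  by rewrite M0E wE//= uD.
have -> : (#|E| - s)%N = #|E :\: D|.
  rewrite cardsD -Ds; congr (_ - _)%N; apply: eq_card => u; rewrite inE.
  by case: (boolP (u \in D)) => [/DE ->//|]; rewrite andbF.
rewrite -prodr_const; apply: eq_big => [u|u /andP[uE uD]]; first by rewrite inE andbC.
by rewrite M0E wE//= (negPf uD).
Qed.

(** Relative entropy is superadditive over disjoint windows when the reference
    measure is a product, and conditioning a measure on an event of probability
    [P] costs an entropy of at most [- ln P].  Both facts are one application of
    [ln x <= x / c - 1 + ln c] to the product over the windows of the likelihood
    ratios, which has mean 1 under the product measure. *)
Lemma relative_entropy_windows (A : {set mat}) (k : nat) (V : finType)
    (phi : V -> 'I_k -> U) p (mu : {ffun 'I_k -> bool} -> R) (w0 : R) :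
  (0 < #|A|)%N -> 0 < w0 -> (forall M, M \in A -> W M = w0) -> (forall u b, 0 <= w u b) ->
  0 < p < 1 -> (forall v t, w (phi v t) =1 bernoulli_pmf p) ->
  (forall v v' t t', phi v t = phi v' t' -> v = v' /\ t = t') ->
  (forall v, law (uniform_pmf R A) (window (phi v)) =1 mu) ->
  #|V|%:R * relative_entropy mu (iid_bernoulli k p) <= - ln (#|A|%:R * w0).
Proof.
move=> A0 w00 Ww0 w_ge0 p01 wphi phi_inj lawmu.
have A0R : 0 < #|A|%:R :> R by rewrite ltr0n.
set q := iid_bernoulli k p.
have q0 x : 0 < q x by exact: iid_bernoulli_gt0.
have [V0|/card_gt0P[v0 _]] := posnP #|V|.
  rewrite V0 mul0r oppr_ge0 ln_le0// -[leRHS]expect_total /expect.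
  rewrite (bigID (mem A))/= ler_wpDr ?sumr_ge0//.
    by move=> M _; rewrite mulr1; apply: prodr_ge0.
  by rewrite mulr_natl (eq_bigr (fun=> w0)) ?sumr_const// => M MA; rewrite mulr1 Ww0.
have mu0 x : 0 <= mu x by rewrite -(lawmu v0) law_ge0.
have mu_gt0 v M : M \in A -> 0 < mu (window (phi v) M).
  by move=> MA; rewrite -(lawmu v) law_mean (mean_gt0 A0 MA)// eqxx.
pose L M := \prod_(v : V) (mu (window (phi v) M) / q (window (phi v) M)).
have L1 : expect L = 1.
  rewrite /L; rewrite (@expect_prod V _ (fun v => [set phi v t | t in 'I_k])
    (fun v M => mu (window (phi v) M) / q (window (phi v) M))).
  - rewrite big1// => v _.
    rewrite (@expect_window k (phi v) p (fun x => mu x / q x))//; last by move=> t t' /phi_inj[].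
    rewrite -(@law_total R _ A A0 _ (window (phi v))); apply: eq_bigr => x _.
    by rewrite lawmu -/q mulrCA divff ?mulr1// gt_eqF.
  - exact: index_enum_uniq.
  - move=> v M M' MM'; rewrite (_ : window (phi v) M = window (phi v) M')//.
    by apply/ffunP => t; rewrite !ffunE; apply: MM'; exact: imset_f.
  - by move=> v v' u /imsetP[t _ ->] /imsetP[t' _ /phi_inj[]].
have L_gt0 M : M \in A -> 0 < L M.
  by move=> MA; apply: prodr_gt0 => v _; rewrite divr_gt0 ?mu_gt0.
have -> : #|V|%:R * relative_entropy mu q = mean A (fun M => ln (L M)).
  transitivity (\sum_(v : V) relative_entropy mu q); first by rewrite sumr_const -[RHS]mulr_natl.
  transitivity (mean A (fun M => \sum_(v : V) ln (mu (window (phi v) M) / q (window (phi v) M)))).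
    rewrite mean_sum; apply: eq_bigr => v _.
    rewrite -(@sum_law R _ A _ (window (phi v)) (fun x => ln (mu x / q x))).
    by apply: eq_bigr => x _; rewrite lawmu.
  apply: eq_mean => M MA; rewrite /L.
  have : forall s : seq V, \sum_(v <- s) ln (mu (window (phi v) M) / q (window (phi v) M)) =
      ln (\prod_(v <- s) (mu (window (phi v) M) / q (window (phi v) M))).
    elim=> [|v s IH]; first by rewrite !big_nil ln1.
    rewrite !big_cons IH [RHS]lnM ?posrE ?divr_gt0 ?mu_gt0//.
    by apply: prodr_gt0 => v' _; rewrite divr_gt0 ?mu_gt0.
  exact.
set c := (#|A|%:R * w0)^-1.
have c0 : 0 < c by rewrite invr_gt0 mulr_gt0.
rewrite (_ : - ln _ = ln c); last by rewrite lnV ?posrE ?mulr_gt0.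
apply: (@le_trans _ _ (mean A (fun M => c^-1 * L M + (ln c - 1)))).
  apply: le_mean => M MA.
  have -> : ln (L M) = ln (c^-1 * L M) + ln c.
    have lncV : ln c^-1 = - ln c by rewrite lnV ?posrE.
    have -> : ln (c^-1 * L M) = ln c^-1 + ln (L M).
      by rewrite lnM ?posrE//; [rewrite invr_gt0|exact: L_gt0].
    by rewrite lncV addrAC addNr add0r.
  have : ln (c^-1 * L M) <= c^-1 * L M - 1.
    by apply: ln_leB1; apply: mulr_gt0; [rewrite invr_gt0|exact: L_gt0].
  lra.
rewrite meanD mean_cst// meanZ.
suff : c^-1 * mean A L <= 1 by lra.
have -> : c^-1 * mean A L = w0 * \sum_(M in A) L M.
  by rewrite /c invrK /mean; field; rewrite gt_eqF.
rewrite -L1 mulr_sumr.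
rewrite /expect [leRHS](bigID (mem A))/= ler_wpDr//; last first.
  by rewrite le_eqVlt; apply/orP; left; apply/eqP; apply: eq_bigr => M MA; rewrite Ww0.
apply: sumr_ge0 => M _; rewrite mulr_ge0//; first exact: prodr_ge0.
by apply: prodr_ge0 => v _; rewrite divr_ge0// ltW.
Qed.

End ProductMeasure.

(** * Point masses of binomial laws *)

Section BinomialMode.

(** Consecutive terms of the expansion of [(s + (N - s)) ^ N] increase up to the
    index [s] and decrease afterwards, so the term of index [s] is at least the
    average of the [N + 1] terms. *)
Lemma binomial_mode (N s : nat) : (s <= N)%N ->
  (N ^ N <= N.+1 * ('C(N, s) * s ^ s * (N - s) ^ (N - s)))%N.
Proof.
move=> sN; pose t i := ('C(N, i) * s ^ i * (N - s) ^ (N - i))%N.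
have step i : (i < N)%N -> (t i.+1 * (i.+1 * (N - s)) = t i * ((N - i) * s))%N.
  move=> iN; have := mul_bin_left N i; rewrite /t.
  have -> : (N - i)%N = (N - i.+1).+1 by lia.
  rewrite !expnS; move: (N - s)%N (N - i.+1)%N => a d H.
  transitivity (i.+1 * 'C(N, i.+1) * (s * s ^ i * a ^ d * a))%N; first by ring.
  by rewrite H; ring.
have up i : (i < s)%N -> (t i <= t i.+1)%N.
  move=> si; have iN : (i < N)%N by lia.
  have [Ns|Ns] : N = s \/ (s < N)%N by lia.
    by rewrite /t -Ns subnn exp0n ?muln0// subn_gt0.
  have c0 : (0 < i.+1 * (N - s))%N by rewrite muln_gt0 subn_gt0.
  rewrite -(leq_pmul2r c0) step// leq_mul2l; apply/orP; right; nia.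
have down i : (s <= i < N)%N -> (t i.+1 <= t i)%N.
  move=> /andP[si iN]; have c0 : (0 < i.+1 * (N - s))%N by rewrite muln_gt0 subn_gt0 (leq_ltn_trans si).
  rewrite -(leq_pmul2r c0) step// leq_mul2l; apply/orP; right; nia.
have mode i : (i <= N)%N -> (t i <= t s)%N.
  move=> iN; have [is_|si] := leqP i s.
    have -> : i = (s - (s - i))%N by lia.
    have : (s - i <= s)%N by lia.
    elim: (s - i)%N => [|d IH] ds; first by rewrite subn0.
    apply: leq_trans (IH _); last by lia.
    have -> : (s - d)%N = (s - d.+1).+1 by lia.
    by apply: up; lia.
  have -> : i = (s + (i - s))%N by lia.
  have : (s + (i - s) <= N)%N by lia.
  elim: (i - s)%N => [|d IH] ds; first by rewrite addn0.
  apply: leq_trans (IH _); last by lia.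
  by rewrite addnS down//; lia.
have {1}-> : N = (N - s + s)%N by lia.
rewrite expnDn -[('C(N, s) * s ^ s * (N - s) ^ (N - s))%N]/(t s).
apply: (@leq_trans (\sum_(i < N.+1) t s)); last by rewrite sum_nat_const card_ord.
apply: leq_sum => i _; rewrite [((N - s) ^ _ * _)%N]mulnC mulnA.
by apply: mode; rewrite -ltnS.
Qed.

(** When the success probability is [q = s / N], the point [s] is the mode.
    Replacing [q] by [p] multiplies the mass by the inverse of
    [(q / p) ^ s * ((1 - q) / (1 - p)) ^ (N - s)], and [x <= exp (x - 1)] bounds
    the latter by [exp (N (q - p)^2 / (p (1 - p)))]. *)
Lemma binomial_point_ge (R : realType) (N s : nat) (p : R) :
  (0 < N)%N -> (s <= N)%N -> 0 < p < 1 ->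
  expR (- ((s%:R - N%:R * p) ^+ 2 / (N%:R * (p * (1 - p))))) / N.+1%:R <=
  'C(N, s)%:R * p ^+ s * (1 - p) ^+ (N - s).
Proof.
move=> N0 sN /andP[p0 p1]; have p1' : 0 < 1 - p by rewrite subr_gt0.
have N0R : 0 < N%:R :> R by rewrite ltr0n.
have expo x n (c : R) : 0 <= x -> 0 < c -> (x / c) ^+ n <= expR (n%:R * (x / c - 1)).
  move=> x0 c0; rewrite expRM_natl; apply: lerXn2r.
  - by rewrite nnegrE divr_ge0// ltW.
  - by rewrite nnegrE expR_ge0.
  by have := expR_ge1Dx (x / c - 1); rewrite addrC subrK.
set q := s%:R / N%:R : R.
have q' : 1 - q = (N - s)%:R / N%:R by rewrite /q natrB//; field; rewrite gt_eqF.
have := binomial_mode sN; rewrite -(ler_nat R) !natrM !natrX => mode.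
have modeq : 1 <= N.+1%:R * ('C(N, s)%:R * q ^+ s * (1 - q) ^+ (N - s)).
  rewrite q' /q !expr_div_n.
  have -> : N.+1%:R * ('C(N, s)%:R * (s%:R ^+ s / N%:R ^+ s) * ((N - s)%:R ^+ (N - s) / N%:R ^+ (N - s)))
     = N.+1%:R * ('C(N, s)%:R * s%:R ^+ s * (N - s)%:R ^+ (N - s)) / N%:R ^+ N :> R.
    have -> : N%:R ^+ N = N%:R ^+ s * N%:R ^+ (N - s) :> R by rewrite -exprD subnKC.
    have := expf_neq0 s (lt0r_neq0 N0R); have := expf_neq0 (N - s) (lt0r_neq0 N0R).
    by move: (N%:R ^+ (N - s)) (N%:R ^+ s) => a b a0 b0; field; rewrite a0 b0.
  by rewrite ler_pdivlMr ?exprn_gt0// mul1r.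
rewrite ler_pdivrMr ?ltr0n// expRN.
have := expo q s p; have := expo (1 - q) (N - s)%N (1 - p).
have q0 : 0 <= q by rewrite divr_ge0.
have q1 : 0 <= 1 - q by rewrite q' divr_ge0.
move=> /(_ q1 p1') H2 /(_ q0 p0) H1.
have H : (q / p) ^+ s * ((1 - q) / (1 - p)) ^+ (N - s) <=
   expR ((s%:R - N%:R * p) ^+ 2 / (N%:R * (p * (1 - p)))).
  have -> : (s%:R - N%:R * p) ^+ 2 / (N%:R * (p * (1 - p))) =
     s%:R * (q / p - 1) + (N - s)%:R * ((1 - q) / (1 - p) - 1).
    by rewrite /q natrB//; field; rewrite !gt_eqF.
  by rewrite expRD ler_pM// exprn_ge0// divr_ge0// ltW.
set a := N.+1%:R in modeq *.
have Ea : a * ('C(N, s)%:R * q ^+ s * (1 - q) ^+ (N - s)) =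
   a * ('C(N, s)%:R * p ^+ s * (1 - p) ^+ (N - s)) * ((q / p) ^+ s * ((1 - q) / (1 - p)) ^+ (N - s)).
  have := expf_neq0 s (lt0r_neq0 p0); have := expf_neq0 (N - s) (lt0r_neq0 p1').
  rewrite !expr_div_n; move: ((1 - p) ^+ (N - s)) (p ^+ s) => u v u0 v0; field; by rewrite u0 v0 expf_neq0 ?(lt0r_neq0 N0R).
rewrite -[leLHS]mul1r ler_pdivrMr ?expR_gt0//.
apply: le_trans modeq _; rewrite Ea [_ * a]mulrC.
by apply: ler_wpM2l => //; rewrite !mulr_ge0// exprn_ge0// ltW.
Qed.

End BinomialMode.

(** * Matrices with two classes of rows and columns *)

Section TwoBlocks.
Variables (R : realType) (m n : nat).
Local Notation U := ('I_(m + n) * 'I_(m + n))%type.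
Local Notation mat := 'M[bool]_(m + n).

Definition heavy (i : 'I_(m + n)) : bool := (i < m)%N.

Definition by_block T (x y z : T) (b1 b2 : bool) : T :=
  if b1 then (if b2 then x else y) else (if b2 then y else z).

Definition block (b : bool * bool) : {set U} :=
  [set u | (heavy u.1 == b.1) && (heavy u.2 == b.2)].

Definition two_margins (h l : nat) (b : bool) : nat := if b then h else l.

Lemma card_heavy b : #|[pred i | heavy i == b]| = two_margins m n b.
Proof.
rewrite -sum1_card big_split_ord/=.
have E1 : (\sum_(i < m | heavy (lshift n i) == b) 1 = if b then m else 0)%N.
  rewrite (eq_bigl (fun=> b)); last by move=> i; rewrite /heavy/= ltn_ord; case: b.
  by case: b => /=; [rewrite big_const_ord iter_addn mul1n addn0|exact: big_pred0].
have E2 : (\sum_(i < n | heavy (rshift m i) == b) 1 = if b then 0 else n)%N.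
  rewrite (eq_bigl (fun=> ~~ b)); last by move=> i; rewrite /heavy/= ltnNge leq_addr; case: (b).
  by case: (b) => /=; [exact: big_pred0|rewrite big_const_ord iter_addn mul1n addn0].
by rewrite E1 E2; case: (b); rewrite ?addn0.
Qed.

Lemma card_block b : #|block b| = (two_margins m n b.1 * two_margins m n b.2)%N.
Proof.
by rewrite -!card_heavy -cardX; apply: eq_card => u; rewrite !inE.
Qed.

Lemma sum_block_rows (M : mat) b :
  (\sum_(i | heavy i == b) \sum_j M i j =
   \sum_(u in block (b, true)) M u.1 u.2 + \sum_(u in block (b, false)) M u.1 u.2)%N.
Proof.
rewrite pair_big/= (bigID (fun u : U => heavy u.2))/=; congr addn.
  by apply: eq_bigl => u; rewrite inE/= andbT eqb_id.
by apply: eq_bigl => u; rewrite inE/= andbT eqbF_neg.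
Qed.

Lemma sum_block_columns (M : mat) b :
  (\sum_(j | heavy j == b) \sum_i M i j =
   \sum_(u in block (true, b)) M u.1 u.2 + \sum_(u in block (false, b)) M u.1 u.2)%N.
Proof.
rewrite pair_big/= (bigID (fun u : U => heavy u.2))/=.
have swapK : involutive (@swap_pair 'I_(m + n) 'I_(m + n)) by case.
rewrite [X in (X + _)%N](reindex_inj (inv_inj swapK)) [X in (_ + X)%N](reindex_inj (inv_inj swapK))/=.
by congr addn; apply: eq_bigl => u; rewrite inE/= andbT ?eqb_id ?eqbF_neg andbC.
Qed.

Definition block_param (a s d : R) (u : U) : R := by_block a s d (heavy u.1) (heavy u.2).

Definition block_weight (a s d : R) (u : U) (b : bool) : R :=
  bernoulli_pmf (block_param a s d u) b.

Definition binomial_point (N k : nat) (p : R) : R :=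
  'C(N, k)%:R * p ^+ k * (1 - p) ^+ (N - k).

Lemma prod_class_exp (x : R) (P : pred U) (F : U -> bool) :
  \prod_u ((if P u then x else 1) ^+ F u) = x ^+ (\sum_(u | P u) F u)%N.
Proof.
rewrite -prodrXr [RHS]big_mkcond/=; apply: eq_bigr => u _.
by case: (P u) => //; rewrite expr1n.
Qed.

(** The relation between the odds says that they are products of a row factor
    ([la] or 1) and a column factor ([mu] or [nu]).  The mass of a matrix is then
    a constant times powers of these factors, whose exponents are the totals of
    the margins over the classes. *)
Lemma block_weight_cst (a s d : R) : 0 < a < 1 -> 0 < s < 1 -> 0 < d < 1 ->
  a / (1 - a) * (d / (1 - d)) = (s / (1 - s)) ^+ 2 ->
  forall (t t' : bool -> nat), exists2 w0 : R, 0 < w0 &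
  forall M, block_tables heavy heavy t t' M ->
    product_pmf (block_weight a s d) M = w0.
Proof.
move=> /andP[a0 a1] /andP[s0 s1] /andP[d0 d1] odds t t'.
have a1' : 0 < 1 - a by rewrite subr_gt0.
have s1' : 0 < 1 - s by rewrite subr_gt0.
have d1' : 0 < 1 - d by rewrite subr_gt0.
pose nu := d / (1 - d); pose mu := s / (1 - s); pose la := mu / nu.
have nu0 : 0 < nu by rewrite divr_gt0.
have mu0 : 0 < mu by rewrite divr_gt0.
have la0 : 0 < la by rewrite divr_gt0.
pose T (f : bool -> nat) b := (\sum_(i | heavy i == b) f b)%N.
exists ((\prod_u (1 - block_param a s d u)) *
        (la ^+ T t true * (mu ^+ T t' true * nu ^+ T t' false))).
  rewrite !mulr_gt0 ?exprn_gt0// prodr_gt0// => u _.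
  by rewrite /block_param /by_block; case: heavy; case: heavy.
move=> M [Hr Hc].
transitivity (\prod_u ((1 - block_param a s d u) *
   ((if heavy u.1 then la else 1) ^+ M u.1 u.2 *
     ((if heavy u.2 then mu else 1) ^+ M u.1 u.2 *
       (if ~~ heavy u.2 then nu else 1) ^+ M u.1 u.2)))).
  apply: eq_bigr => u _; rewrite /block_weight /block_param /by_block /bernoulli_pmf.
  case: (M _ _); rewrite /= ?expr0 ?expr1 ?mulr1//.
  have laE : la = a / (1 - a) / mu.
    by rewrite /la -[a / _](mulfK (lt0r_neq0 nu0)) odds -/mu; field; rewrite !gt_eqF.
  case: heavy => /=; case: heavy => /=; rewrite ?mulr1 ?mul1r.
  - rewrite laE; field; by rewrite !gt_eqF.
  - rewrite /la /mu; field; by rewrite !gt_eqF.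
  - rewrite /mu; field; by rewrite !gt_eqF.
  - rewrite /nu; field; by rewrite !gt_eqF.
rewrite !big_split/=; congr (_ * (_ * (_ * _))).
- rewrite prod_class_exp /T -Hr pair_big/=; congr (_ ^+ _).
  by apply: eq_bigl => u; rewrite andbT eqb_id.
- rewrite prod_class_exp /T -Hc sum_block_columns; congr (_ ^+ _).
  rewrite (bigID (fun u : U => heavy u.1))/=; congr addn;
  by apply: eq_bigl => u; rewrite inE/= andbC ?eqb_id ?eqbF_neg.
rewrite prod_class_exp /T -Hc sum_block_columns; congr (_ ^+ _).
rewrite (bigID (fun u : U => heavy u.1))/=; congr addn;
by apply: eq_bigl => u; rewrite inE/= andbC ?eqb_id ?eqbF_neg.
Qed.

(** The matrices with block sums [x], [y], [y] and [z] have the same margin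
    totals as the tables, hence the same mass, and by balancing they are at most
    [(m + n + 1) ^ (2 (m + n))] times as many.  The blocks being independent, the
    mass of this set is a product of four binomial point masses. *)
Lemma tables_mass_ge (h l x y z : nat) (a s d : R) :
  0 < a < 1 -> 0 < s < 1 -> 0 < d < 1 ->
  a / (1 - a) * (d / (1 - d)) = (s / (1 - s)) ^+ 2 ->
  (x + y = m * h)%N -> (y + z = n * l)%N ->
  let A := binary_tables (two_margins h l \o heavy) (two_margins h l \o heavy) in
  exists w0 : R, [/\ 0 < w0,
    forall M, M \in A -> product_pmf (block_weight a s d) M = w0 &
    binomial_point (m * m) x a * binomial_point (m * n) y s ^+ 2 *
      binomial_point (n * n) z d <=
    (m + n).+1%:R ^+ (m + n) ^+ 2 * (#|A|%:R * w0)].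
Proof.
move=> a01 s01 d01 odds xy yz A.
have [w0 w00 Ww0] := block_weight_cst a01 s01 d01 odds (two_margins h l) (two_margins h l).
exists w0; split=> //.
  move=> M /binary_tablesP[Hr Hc]; apply: Ww0; split=> b.
    by apply: eq_bigr => i /eqP <-; rewrite Hr.
  by apply: eq_bigr => i /eqP <-; rewrite Hc.
pose bsum b (M : mat) := (\sum_(u in block b) M u.1 u.2)%N.
pose val (b : bool * bool) := by_block x y z b.1 b.2.
pose S := [set M : mat | [forall b, bsum b M == val b]].
have SB M : M \in S -> block_tables heavy heavy (two_margins h l) (two_margins h l) M.
  rewrite inE => /forallP HS.
  have bE b : bsum b M = val b by apply/eqP.
  have tot b : (\sum_(i | heavy i == b) two_margins h l b = two_margins m n b * two_margins h l b)%N.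
    by rewrite sum_nat_const -card_heavy.
  split=> b; rewrite tot ?sum_block_rows ?sum_block_columns -!/(bsum _ M) !bE.
    by case: (b); rewrite /val /by_block/=.
  by case: (b); rewrite /val /by_block/= // addnC.
have cS : (#|S|%:R * w0 : R) <= (m + n).+1%:R ^+ (m + n) ^+ 2 * (#|A|%:R * w0).
  rewrite mulrA; apply: ler_wpM2r; first exact: ltW.
  have := card_block_tables SB; rewrite -(ler_nat R) !natrM !natrX.
  by rewrite -expr2.
apply: le_trans cS.
have sum_w u : \sum_b block_weight a s d u b = 1 by exact: sum_bernoulli_pmf.
have -> : #|S|%:R * w0 = expect (block_weight a s d)
    (fun M => \prod_(b <- index_enum (bool * bool)%type) (bsum b M == val b)%:R).
  transitivity (\sum_(M in S) w0); first by rewrite sumr_const mulr_natl.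
  rewrite big_mkcond/=; apply: eq_bigr => M _.
  case: (boolP (M \in S)) => [MS|].
    rewrite -(Ww0 _ (SB _ MS)) big1 ?mulr1// => b _.
    by move: MS; rewrite inE => /forallP ->.
  rewrite inE negb_forall => /existsP[b /negPf Hb].
  by rewrite (bigD1 b)//= Hb mul0r mulr0.
rewrite (@expect_prod R _ _ _ sum_w _ _ block (fun b M => (bsum b M == val b)%:R)).
- have pt b p : (forall u, u \in block b -> block_param a s d u = p) ->
     expect (block_weight a s d) (fun M => (bsum b M == val b)%:R) =
     binomial_point (two_margins m n b.1 * two_margins m n b.2) (val b) p.
    move=> Hp; rewrite (@expect_block_sum _ _ _ _ sum_w (block b) p).
      by rewrite card_block.
    by move=> u uE c; rewrite /block_weight Hp.
  have par b u : u \in block b -> block_param a s d u = by_block a s d b.1 b.2.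
    by rewrite inE /block_param => /andP[/eqP -> /eqP ->].
  under eq_bigr => b _ do rewrite (pt b _ (par b)).
  rewrite -(pair_bigA _ (fun b1 b2 => binomial_point (two_margins m n b1 * two_margins m n b2)
    (by_block x y z b1 b2) (by_block a s d b1 b2)))/= !big_bool/=.
  rewrite /by_block [(n * m)%N]mulnC expr2. by rewrite !mulrA lexx.
- exact: index_enum_uniq.
- by move=> b M M' MM'; rewrite /bsum (eq_bigr _ (fun u ub => congr1 nat_of_bool (MM' u ub))).
- by move=> [b1 b2] [b1' b2'] u; rewrite !inE/= => /andP[/eqP <- /eqP <-] /andP[/eqP <- /eqP <-].
Qed.

End TwoBlocks.

(** * Symmetries of the tables *)

Lemma rotation_perm (N lo len s : nat) : (lo + len <= N)%N ->
  exists tau : {perm 'I_N},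
    (forall i : 'I_N, (lo <= i < lo + len)%N -> tau i = (lo + (i - lo + s) %% len)%N :> nat) /\
    (forall i : 'I_N, ~~ (lo <= i < lo + len)%N -> tau i = i).
Proof.
move=> loN; pose f (i : nat) := if (lo <= i < lo + len)%N then (lo + (i - lo + s) %% len)%N else i.
have fN (i : 'I_N) : (f i < N)%N.
  rewrite /f; case: ifP => // /andP[h1 h2].
  have len0 : (0 < len)%N by lia.
  by have := ltn_pmod (i - lo + s) len0; lia.
have f_inj : injective (fun i : 'I_N => Ordinal (fN i)).
  move=> i j /(congr1 val)/=; rewrite /f => H; apply: val_inj => /=; move: H.
  case: ifP => hi; case: ifP => hj //.
  - move/eqP; rewrite eqn_add2l eqn_modDr => /eqP.
    by rewrite !modn_small; lia.
  - have len0 : (0 < len)%N by lia.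
    by have := ltn_pmod (i - lo + s) len0; lia.
  - have len0 : (0 < len)%N by lia.
    by have := ltn_pmod (j - lo + s) len0; lia.
exists (perm f_inj); split=> i hi; first by rewrite permE/= /f hi.
by apply: val_inj; rewrite permE/= /f (negPf hi).
Qed.

Section Symmetry.
Variables (R : realType) (m l : nat) (r : 'I_m -> nat) (c : 'I_l -> nat).
Let A := binary_tables r c.

Lemma mean_tables_perm (sigma : {perm 'I_m}) (tau : {perm 'I_l}) (f : 'M[bool]_(m, l) -> R) :
  (forall i, r (sigma i) = r i) -> (forall j, c (tau j) = c j) ->
  mean A f = mean A (fun M => f (row_perm sigma (col_perm tau M))).
Proof.
move=> rs ct; congr (_ * _).
have inj : injective (fun M : 'M[bool]_(m, l) => row_perm sigma (col_perm tau M)).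
  move=> M M' /matrixP H; apply/matrixP => i j.
  by have := H (sigma^-1%g i) (tau^-1%g j); rewrite !mxE !permKV.
rewrite (reindex_inj inj)/=; apply: eq_bigl => M.
apply/binary_tablesP/binary_tablesP => -[Hr Hc]; split=> [i|j].
- rewrite -[i](permKV sigma) rs -Hr (reindex_inj (@perm_inj _ tau))/=.
  by apply: eq_bigr => j _; rewrite !mxE.
- rewrite -[j](permKV tau) ct -Hc (reindex_inj (@perm_inj _ sigma))/=.
  by apply: eq_bigr => i _; rewrite !mxE.
- rewrite -rs -Hr [RHS](reindex_inj (@perm_inj _ tau))/=.
  by apply: eq_bigr => j _; rewrite !mxE.
rewrite -ct -Hc [RHS](reindex_inj (@perm_inj _ sigma))/=.
by apply: eq_bigr => i _; rewrite !mxE.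
Qed.

Lemma entryE (M : 'M[bool]_(m, l)) (i : 'I_m) (j : 'I_l) : entry M i j = M i j.
Proof. by rewrite /entry !valK. Qed.

End Symmetry.

Section Segments.
Variables (R : realType) (m n h l : nat).
Hypothesis m_gt0 : (0 < m)%N.
Local Notation N := (m + n)%N.
Local Notation A := (binary_tables (two_margins h l \o @heavy m n) (two_margins h l \o @heavy m n)).
Hypothesis A_gt0 : (0 < #|A|)%N.

(** The rows of a block, cut into consecutive windows, all carry the same law,
    because rotating the rows and the columns of a block preserves the margins. *)
Lemma relative_entropy_segment (a s d w0 : R) (k : nat) (b : bool) :
  0 < a < 1 -> 0 < s < 1 -> 0 < d < 1 -> 0 < w0 ->
  (forall M, M \in A -> product_pmf (block_weight a s d) M = w0) ->
  (m * (two_margins m n b %/ k))%:R *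
    relative_entropy (law (uniform_pmf R A) (segment 0 (if b then 0 else m) k))
      (iid_bernoulli k (if b then a else s)) <= - ln (#|A|%:R * w0).
Proof.
move=> a01 s01 d01 w00 Ww0.
set len := two_margins m n b; set lo := (if b then 0 else m)%N.
have loN : (lo + len <= N)%N by rewrite /lo /len /two_margins; case: (b); lia.
have posN (q : 'I_(len %/ k)) (t : 'I_k) : (lo + (q * k + t) < N)%N.
  have := ltn_ord q; have := ltn_ord t; have := leq_trunc_div len k; nia.
have posL (q : 'I_(len %/ k)) (t : 'I_k) : (q * k + t < len)%N.
  have := ltn_ord q; have := ltn_ord t; have := leq_trunc_div len k; nia.
pose phi (v : 'I_m * 'I_(len %/ k)) (t : 'I_k) : 'I_N * 'I_N :=
  (lshift n v.1, Ordinal (posN v.2 t)).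
have heavy_lo (j : 'I_N) : (lo <= j < lo + len)%N -> heavy j = b.
  rewrite /heavy /lo /len /two_margins; case: (b) => //=.
  by move=> /andP[]; rewrite leqNgt => /negPf.
have -> : (m * (len %/ k))%N = #|{: 'I_m * 'I_(len %/ k)}| by rewrite card_prod !card_ord.
apply: (@relative_entropy_windows R _ _ (block_weight a s d) _ A k _ phi) => //.
- by move=> u; exact: sum_bernoulli_pmf.
- move=> u c; apply/ltW/bernoulli_pmf_gt0.
  by rewrite /block_param /by_block; case: heavy; case: heavy.
- by case: (b).
- move=> [i q] t c; rewrite /block_weight /block_param /phi/=; congr bernoulli_pmf.
  rewrite {1}/heavy/= ltn_ord heavy_lo/=; first by case: (b).
  by rewrite leq_addr ltn_add2l posL.
- move=> [i q] [i' q'] t t' [/ord_inj/= ii /eqP]; rewrite eqn_add2l => /eqP qt.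
  have k0 : (0 < k)%N by case: (t) => t0; case: (k).
  have tt : t = t' :> nat.
    by have := congr1 (modn^~ k) qt; rewrite !modnMDl !modn_small.
  have qq : q = q' :> nat.
    by move: qt; rewrite tt => /eqP; rewrite eqn_add2r eqn_pmul2r// => /eqP.
  by split; [rewrite (ord_inj qq) ii|exact: ord_inj].
move=> [i q] x; rewrite !law_mean.
have [tau [tau1 tau2]] := rotation_perm (q * k) loN.
pose i0 : 'I_m := Ordinal m_gt0.
rewrite [RHS](@mean_tables_perm R _ _ _ _ (tperm (lshift n i0) (lshift n i)) tau)/=.
- apply: eq_mean => M _; congr (nat_of_bool (_ == _))%:R.
  apply/ffunP => t; rewrite !ffunE /phi/=.
  have loN' : (lo + t < N)%N by have := posL q t; lia.
  rewrite (entryE _ (lshift n i0) (Ordinal loN')) !mxE tpermL; congr (M _ _).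
  apply: val_inj => /=; rewrite tau1/=; last by have := posL q t; lia.
  by rewrite addKn (addnC t) modn_small // posL.
- by move=> j; rewrite /heavy; case: tpermP => [->|->|_ _]/=; rewrite ?ltn_ord ?m_gt0.
- move=> j; congr two_margins; case: (boolP (lo <= j < lo + len)%N) => hj; last by rewrite tau2.
  rewrite !heavy_lo// tau1// leq_addr ltn_add2l ltn_pmod//; lia.
Qed.

Hypothesis n_gt0 : (0 < n)%N.

(** The entries of a light row in the light columns are exchangeable, and their
    sum differs from the row sum by the entries in the [m] heavy columns. *)
Lemma relative_entropy_light_segment (C : R) (k : nat) : (k <= n)%N -> 0 < C < 1 ->
  `|l%:R - C * n%:R| <= 1 ->
  relative_entropy (law (uniform_pmf R A) (segment m m k)) (iid_bernoulli k C) <=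
  \sum_(t < k) ((n - t)%:R^-1 + m.+1%:R / n.-1%:R) / (C * (1 - C)).
Proof.
move=> kn C01 lC.
pose i0 : 'I_n := Ordinal n_gt0.
apply: (@relative_entropy_exchangeable R _ A n
   (fun j M => M (rshift m i0) (rshift m j)) C m.+1%:R A_gt0 C01 _ _ k kn) => //.
- move=> i j f; rewrite (@mean_tables_perm R _ _ _ _ 1%g (tperm (rshift m i) (rshift m j)))//=.
    apply: eq_mean => M _; congr f; apply: funext => l'; rewrite !mxE perm1.
    congr (M _ _); rewrite permE/= permE/= !(inj_eq (@rshift_inj _ _)).
    by case: ifP => // _; case: ifP.
  by move=> i'; rewrite perm1.
  by move=> j'; case: tpermP => [->|->|//]; rewrite /heavy/= !ltnNge !leq_addr.
- move=> M /binary_tablesP[Hr _]; have := Hr (rshift m i0).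
  rewrite /= /heavy/= ltnNge leq_addr/= big_split_ord/= => HS.
  have Sm : (\sum_(j < m) M (rshift m i0) (lshift n j) <= m)%N.
    by rewrite -[leqRHS]card_ord -sum1_card; apply: leq_sum => j _; exact: leq_b1.
  rewrite -natr_sum; move: lC; rewrite -HS natrD.
  move: (\sum_(i < n) _)%N (\sum_(j < m) _)%N Sm => x y ym.
  have : (y%:R : R) <= m%:R by rewrite ler_nat.
  have : (0 : R) <= y%:R by [].
  rewrite -[m.+1]addn1 natrD !ler_norml; move: (C * n%:R) => z; lra.
move=> M t; rewrite ffunE -(entryE M); congr entry.
by rewrite /= addn0.
Qed.

End Segments.

(** * The entropy cost of the margins *)

Section Cost.
Variable R : realType.

Lemma ln_binomial_point_ge (N s : nat) (p V : R) :
  (0 < N)%N -> (s <= N)%N -> 0 < p < 1 ->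
  (s%:R - N%:R * p) ^+ 2 <= V * (N%:R * (p * (1 - p))) ->
  0 < binomial_point N s p /\ - (V + ln N.+1%:R) <= ln (binomial_point N s p).
Proof.
move=> N0 sN p01 HV; have := binomial_point_ge N0 sN p01.
have /andP[p0 p1] := p01.
have den : 0 < N%:R * (p * (1 - p)) by rewrite !mulr_gt0 ?ltr0n ?subr_gt0.
set E := expR _; have E0 : 0 < E / N.+1%:R by rewrite divr_gt0 ?expR_gt0 ?ltr0n.
rewrite -/(binomial_point N s p) => H; split; first exact: lt_le_trans H.
have := H; rewrite -ler_ln ?posrE//; last exact: lt_le_trans H.
apply: le_trans; rewrite ln_div ?posrE ?expR_gt0 ?ltr0n// /E expRK opprD lerD2r lerN2.
by rewrite ler_pdivrMr.
Qed.

Lemma card_tables_gt0 (m n h l x y z : nat) :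
  (x <= m * m)%N -> (y <= m * n)%N -> (z <= n * n)%N ->
  (x + y = m * h)%N -> (y + z = n * l)%N ->
  (0 < #|binary_tables (two_margins h l \o @heavy m n) (two_margins h l \o @heavy m n)|)%N.
Proof.
move=> xm ym zn xy yz; set A := binary_tables _ _.
have half : 0 < (2^-1 : R) < 1 by lra.
have [|w0 [w00 _]] := @tables_mass_ge R m n h l x y z 2^-1 2^-1 2^-1 half half half _ xy yz.
  by rewrite expr2.
rewrite -/A lt0n; case: eqP => // ->; rewrite mul0r mulr0 leNgt => /negP[].
have bp (N s : nat) : (s <= N)%N -> 0 < binomial_point N s (2^-1 : R).
  move=> sN; rewrite /binomial_point !mulr_gt0 ?exprn_gt0 ?ltr0n ?bin_gt0 ?invr_gt0//; lra.
apply: mulr_gt0; [apply: mulr_gt0|]; [exact: bp|apply: exprn_gt0; exact: bp|exact: bp].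
Qed.

(** The margins [h] and [l] and the sum [x] of the top left block determine the
    sums [y] and [z] of the other blocks.  The deviations come from the rounding
    of the margins, at most 1 in each row, and from [x], which is at most [m^2]
    while [m * n * (B * C)] is the mean of the whole heavy rows. *)
Lemma block_sum_deviations (m n h l x y z B C d : R) :
  1 <= m -> 0 < n -> 0 <= x <= m * m ->
  x + y = m * h -> y + z = n * l -> n * d = C * n - B * C * m ->
  0 <= B * C * n - h <= 1 -> 0 <= C * n - l <= 1 ->
  `|y - m * n * (B * C)| <= 2 * (m * m) /\
  `|z - n * n * d| <= n + 2 * (m * m).
Proof.
move=> m1 n0 /andP[x0 xm] xy yz nd /andP[h0 h1] /andP[l0 l1].
have mm : m <= m * m by rewrite ler_peMl// (le_trans ler01).
have hm : 0 <= m * (B * C * n - h) <= m by apply/andP; split; nra.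
have lm : 0 <= n * (C * n - l) <= n by apply/andP; split; nra.
have nnd : n * n * d = n * (C * n) - n * (B * C * m) by rewrite -mulrA nd mulrBr.
move: hm lm; rewrite !mulrBr -xy -yz => /andP[? ?] /andP[? ?].
rewrite nnd !ler_norml; split; apply/andP; split; lra.
Qed.

(** The entropy cost of conditioning on the margins is of order [n ln n]: the
    pigeonhole factor and the four binomial point masses at their modes cost
    [O(n ln n)], and the deviations of the block sums from their means, at most
    [1], [2 m^2] and [n + 2 m^2], cost [O(n)] since [m^3 <= n^2]. *)
Lemma tables_cost (m n h l : nat) (B C a d c : R) :
  0 < c -> 0 < a < 1 -> 0 < B * C < 1 -> 0 < d < 1 ->
  c <= a * (1 - a) -> c <= B * C * (1 - B * C) -> c <= d * (1 - d) ->
  a / (1 - a) * (d / (1 - d)) = (B * C / (1 - B * C)) ^+ 2 ->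
  n%:R * d = C * n%:R - B * C * m%:R ->
  (0 < m)%N -> (m <= n)%N -> (m ^ 3 <= n ^ 2)%N -> 1 <= ln n%:R :> R ->
  (m <= h <= n)%N -> (m <= l <= n)%N ->
  0 <= B * C * n%:R - h%:R <= 1 -> 0 <= C * n%:R - l%:R <= 1 ->
  let A := binary_tables (two_margins h l \o @heavy m n) (two_margins h l \o @heavy m n) in
  (0 < #|A|)%N /\
  exists w0 : R, [/\ 0 < w0, forall M, M \in A -> product_pmf (block_weight a (B * C) d) M = w0 &
    - ln (#|A|%:R * w0) <= (24 + 19 / c) * (n%:R * ln n%:R)].
Proof.
move=> c0 a01 s01 d01 ca cs cd odds nd m0 mn m3 ln1 /andP[mh hn] /andP[ml ln_] hB lC A.
have n2 : (2 <= n)%N.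
  rewrite ltnNge; apply/negP => n1; have : ln n%:R <= 0 :> R.
    by apply: ln_le0; rewrite -[1]/(1%:R) ler_nat.
  by move: ln1; lra.
have n0 : (0 < n)%N by exact: leq_trans n2.
(* The sum of the top left block is its mean, rounded; the margins determine the
   sums of the other blocks. *)
pose x := Num.truncn (a * (m * m)%:R); pose y := (m * h - x)%N; pose z := (n * l - y)%N.
have a0 : 0 <= a by case/andP: a01 => /ltW.
have x0 : 0 <= a * (m * m)%:R by rewrite mulr_ge0.
have /andP[x1 x2] : x%:R <= a * (m * m)%:R < x.+1%:R by rewrite truncn_itv.
have xm : (x <= m * m)%N.
  rewrite -(ler_nat R); apply: le_trans x1 _.
  by rewrite -[leRHS]mul1r ler_wpM2r//; case/andP: a01 => _ /ltW.
have xmh : (x <= m * h)%N by apply: leq_trans xm _; rewrite leq_mul2l mh orbT.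
have xy : (x + y = m * h)%N by rewrite subnKC.
have ym : (y <= m * n)%N.
  by apply: leq_trans (leq_subr _ _) _; rewrite leq_mul2l hn orbT.
have ynl : (y <= n * l)%N by apply: leq_trans ym _; rewrite mulnC leq_mul2l ml orbT.
have yz : (y + z = n * l)%N by rewrite subnKC.
have zn : (z <= n * n)%N.
  by apply: leq_trans (leq_subr _ _) _; rewrite leq_mul2l ln_ orbT.
have A0 : (0 < #|A|)%N by exact: card_tables_gt0 xm ym zn xy yz.
split=> //.
have [w0 [w00 Ww0 mass]] := tables_mass_ge a01 s01 d01 odds xy yz.
exists w0; split=> //.
have mR1 : 1 <= m%:R :> R by rewrite -[1]/(1%:R) ler_nat.
have mnR : m%:R <= n%:R :> R by rewrite ler_nat.
have n1R : 1 <= n%:R :> R by exact: le_trans mnR.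
have m3R : m%:R ^+ 3 <= n%:R ^+ 2 :> R by rewrite -!natrX ler_nat.
have xyR : x%:R + y%:R = m%:R * h%:R :> R by rewrite -natrD xy natrM.
have yzR : y%:R + z%:R = n%:R * l%:R :> R by rewrite -natrD yz natrM.
have xmR : x%:R <= m%:R * m%:R :> R by rewrite -natrM ler_nat.
have x0R : 0 <= x%:R :> R by [].
move: x1 x2; rewrite -[x.+1]addn1 natrD natrM => x1 x2.
have mm1 : 1 <= m%:R * m%:R :> R by nra.
have mmm : m%:R <= m%:R * m%:R :> R by nra.
have nn : 0 < n%:R :> R by lra.
have mm : 0 < m%:R :> R by lra.
set mr := m%:R in mR1 mnR m3R xyR xmR x1 x2 mm1 mmm mm nd; set nr := n%:R in mnR n1R m3R yzR nn nd hB lC ln1 *.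
have m4 : (mr * mr) ^+ 2 <= nr ^+ 3.
  have -> : (mr * mr) ^+ 2 = mr * mr ^+ 3 by ring.
  have -> : nr ^+ 3 = nr * nr ^+ 2 by ring.
  by apply: ler_pM => //; apply: exprn_ge0; apply: ltW.
have [D12 D22] := block_sum_deviations mR1 nn (introT andP (conj x0R xmR)) xyR yzR nd hB lC.
have [P11 H11] : 0 < binomial_point (m * m) x a /\ - (c^-1 + ln (m * m).+1%:R) <= ln (binomial_point (m * m) x a).
  apply: ln_binomial_point_ge => //; first by rewrite muln_gt0 m0.
  rewrite natrM -/mr; apply: (@le_trans _ _ 1).
    by rewrite -[_ ^+ 2]real_normK ?num_real// expr_le1 ?normr_ge0// ler_norml; lra.
  apply: (@le_trans _ _ (c^-1 * (1 * c))); first by rewrite mul1r mulVf ?gt_eqF.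
  apply: ler_wpM2l; first by rewrite invr_ge0 ltW.
  by apply: ler_pM => //; exact: ltW.
have [P12 H12] : 0 < binomial_point (m * n) y (B * C) /\ - (4 * nr / c + ln (m * n).+1%:R) <= ln (binomial_point (m * n) y (B * C)).
  apply: ln_binomial_point_ge => //; first by rewrite muln_gt0 m0 n0.
  rewrite natrM -/mr -/nr; apply: (@le_trans _ _ ((2 * (mr * mr)) ^+ 2)).
    by rewrite -[leLHS]real_normK ?num_real// ler_sqr// nnegrE; nra.
  apply: (@le_trans _ _ (4 * nr / c * (mr * nr * c))).
    rewrite (_ : 4 * nr / c * (mr * nr * c) = 4 * mr * nr ^+ 2); last by field; rewrite gt_eqF.
    have -> : (2 * (mr * mr)) ^+ 2 = 4 * mr * mr ^+ 3 by ring.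
    by rewrite ler_wpM2l//; lra.
  apply: ler_wpM2l; first by rewrite divr_ge0 ?mulr_ge0// ltW.
  by apply: ler_wpM2l => //; rewrite mulr_ge0.
have [P22 H22] : 0 < binomial_point (n * n) z d /\ - (10 * nr / c + ln (n * n).+1%:R) <= ln (binomial_point (n * n) z d).
  apply: ln_binomial_point_ge => //; first by rewrite muln_gt0 n0.
  rewrite natrM -/nr; apply: (@le_trans _ _ ((nr + 2 * (mr * mr)) ^+ 2)).
    by rewrite -[leLHS]real_normK ?num_real// ler_sqr// nnegrE; nra.
  apply: (@le_trans _ _ (10 * nr / c * (nr * nr * c))).
    rewrite (_ : 10 * nr / c * (nr * nr * c) = 10 * nr ^+ 3); last by field; rewrite gt_eqF.
    apply: (@le_trans _ _ (2 * nr ^+ 2 + 8 * (mr * mr) ^+ 2)).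
      by have := sqr_ge0 (nr - 2 * (mr * mr)); nra.
    have : nr ^+ 2 <= nr ^+ 3 by rewrite [leRHS]exprS ler_peMl// sqr_ge0.
    lra.
  apply: ler_wpM2l; first by rewrite divr_ge0 ?mulr_ge0// ltW.
  by apply: ler_wpM2l => //; rewrite mulr_ge0.
have Aw : 0 < #|A|%:R * w0 by rewrite mulr_gt0 ?ltr0n.
have N0 : 0 < (m + n).+1%:R :> R by rewrite ltr0n.
have E1 : ln (binomial_point (m * m) x a * binomial_point (m * n) y (B * C) ^+ 2 * binomial_point (n * n) z d) =
    ln (binomial_point (m * m) x a) + ln (binomial_point (m * n) y (B * C)) *+ 2 + ln (binomial_point (n * n) z d).
  move: P11 P12 P22; move: (binomial_point _ _ _) (binomial_point _ _ _) (binomial_point _ _ _) => u v w u0 v0 w0'.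
  by rewrite lnM ?posrE ?mulr_gt0 ?exprn_gt0// lnM ?posrE ?exprn_gt0// lnXn.
have E2 : ln ((m + n).+1%:R ^+ (m + n) ^+ 2 * (#|A|%:R * w0)) =
    ln (m + n).+1%:R *+ (m + n) *+ 2 + ln (#|A|%:R * w0).
  by rewrite lnM ?posrE ?exprn_gt0// lnXn ?exprn_gt0// lnXn.
have Pm : 0 < binomial_point (m * m) x a * binomial_point (m * n) y (B * C) ^+ 2 * binomial_point (n * n) z d.
  by apply: mulr_gt0 => //; apply: mulr_gt0 => //; apply: exprn_gt0.
have : ln (binomial_point (m * m) x a * binomial_point (m * n) y (B * C) ^+ 2 * binomial_point (n * n) z d)
   <= ln ((m + n).+1%:R ^+ (m + n) ^+ 2 * (#|A|%:R * w0)).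
  rewrite ler_ln ?posrE //; exact: lt_le_trans mass.
rewrite E1 E2.
have lnle (k : nat) : (0 < k <= n ^ 3)%N -> ln k%:R <= 3 * ln nr.
  move=> /andP[k0 kn]; rewrite mulr_natl -lnXn// ler_ln ?posrE ?exprn_gt0 ?ltr0n//.
  by rewrite -natrX ler_nat.
have nnn (k : nat) : (k <= n * n)%N -> (0 < k.+1 <= n ^ 3)%N.
  by move: n2; clear; rewrite !expnS expn0 muln1 => n2 kn; nia.
have L1 : ln (m * m).+1%:R <= 3 * ln nr by apply/lnle/nnn/leq_mul.
have L2 : ln (m * n).+1%:R <= 3 * ln nr by apply/lnle/nnn/leq_mul.
have L3 : ln (n * n).+1%:R <= 3 * ln nr by apply/lnle/nnn.
have L4 : ln (m + n).+1%:R <= 3 * ln nr.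
  by apply/lnle/nnn; move: n2 mn; clear; nia.
have L5 : ln (m + n).+1%:R *+ (m + n) *+ 2 <= 12 * (nr * ln nr).
  rewrite -mulrnA -[_ *+ _]mulr_natl natrM natrD -/mr -/nr.
  have : 0 <= ln (m + n).+1%:R :> R by rewrite ln_ge0// -[1]/(1%:R) ler_nat.
  by nra.
have L6 : ln nr <= nr * ln nr by rewrite ler_peMl//; lra.
have L7 : nr / c <= nr * ln nr / c.
  by apply: ler_wpM2r; rewrite ?invr_ge0 ?ler_peMr// ltW.
have L8 : c^-1 <= nr / c by rewrite ler_peMl// invr_ge0; exact: ltW.
rewrite mulrDl [19 / c * _]mulrAC -[19 * _ / c]mulrA.
move: H11 H12 H22 L7 L8 L5; rewrite -!mulrA.
move: L1 L2 L3 L6; clear; lra.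
Qed.

End Cost.

(** * Bottom right block *)

Local Open Scope classical_set_scope.
Local Open Scope ring_scope.

Section Asymptotics.
Variable R : realType.
Implicit Types (B C delta e : R) (n : nat).

Lemma near_powR_ge (x b : R) : 0 < b -> \forall n \near \oo, x <= n%:R `^ b.
Proof.
move=> b0; have [X0|X0] := leP x 0.
  by near=> n; rewrite (le_trans X0) ?powR_ge0.
near=> n; have H : x `^ b^-1 <= n%:R by near: n; exact: nbhs_infty_ger.
have -> : x = (x `^ b^-1) `^ b by rewrite -powRrM mulVf ?gt_eqF// powRr1// ltW.
by apply: ge0_ler_powR H; rewrite ?nnegrE ?powR_ge0 //; exact: ltW.
Unshelve. all: by end_near. Qed.

Lemma powR_natD (n : nat) (a b : R) : (0 < n)%N -> n%:R `^ a * n%:R `^ b = n%:R `^ (a + b).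
Proof. by move=> n0; rewrite powRD// pnatr_eq0 -lt0n n0 implybT. Qed.

Lemma ler_powR_nat n (a b : R) : (0 < n)%N -> a <= b -> n%:R `^ a <= n%:R `^ b.
Proof. by move=> n0 ab; apply: ler_powR => //; rewrite -[1]/(1%:R) ler_nat. Qed.

Lemma near_powR_le (a b e : R) : a < b -> 0 < e ->
  \forall n \near \oo, n%:R `^ a <= e * n%:R `^ b.
Proof.
move=> ab e0; near=> n.
have n0 : (0 < n)%N by near: n; exact: nbhs_infty_gt.
have H : e^-1 <= n%:R `^ (b - a) by near: n; apply: near_powR_ge; rewrite subr_gt0.
rewrite -(subrK a b) -powR_natD// mulrA ler_peMl ?powR_ge0//.
by rewrite -ler_pdivrMl// mulr1.
Unshelve. all: by end_near. Qed.

Lemma nblock_le delta n : (nblock delta n)%:R <= n%:R `^ delta :> R.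
Proof. by rewrite /nblock truncn_le powR_ge0. Qed.

Lemma nblock_gt0 delta n : 0 <= delta -> (0 < n)%N -> (0 < nblock delta n)%N.
Proof.
move=> d0 n0; rewrite /nblock truncn_gt0 -[leLHS](powRr0 n%:R); exact: ler_powR_nat.
Qed.

Lemma nblock_ge delta n : 0 <= delta -> (0 < n)%N ->
  n%:R `^ delta <= 2 * (nblock delta n)%:R :> R.
Proof.
move=> d0 n0; have := nblock_gt0 d0 n0; rewrite -(ler_nat R) => m1.
have /andP[_] : (nblock delta n)%:R <= n%:R `^ delta < (nblock delta n).+1%:R by rewrite truncn_itv// powR_ge0.
by rewrite -addn1 natrD; lra.
Qed.

Lemma near_nblock_le delta e : delta < 1 -> 0 < e ->
  \forall n \near \oo, (nblock delta n)%:R <= e * n%:R :> R.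
Proof.
move=> d1 e0; near=> n.
apply: le_trans (nblock_le _ _) _; rewrite -[X in _ * X]powRr1//.
by near: n; exact: near_powR_le.
Unshelve. all: by end_near. Qed.

Lemma tables_two_margins B C delta n :
  tables B C delta n =
  binary_tables (two_margins (Num.truncn (B * C * n%:R)) (Num.truncn (C * n%:R)) \o @heavy (nblock delta n) n)
                (two_margins (Num.truncn (B * C * n%:R)) (Num.truncn (C * n%:R)) \o @heavy (nblock delta n) n).
Proof. by []. Qed.

Lemma cvg_sqr0 (f : nat -> R) : (forall e, 0 < e -> \forall n \near \oo, f n ^+ 2 <= e) ->
  f n @[n --> \oo] --> (0 : R).
Proof.
move=> H; apply/cvgrPdist_le => /= e e0; near=> n.
rewrite sub0r normrN -ler_sqr ?nnegrE//; last exact: ltW.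
by rewrite real_normK ?num_real//; near: n; apply: H; rewrite exprn_gt0.
Unshelve. all: by end_near. Qed.

Lemma truncn_diff (x : R) : 0 <= x -> 0 <= x - (Num.truncn x)%:R <= 1.
Proof.
move=> x0; have /andP[] : (Num.truncn x)%:R <= x < (Num.truncn x).+1%:R by rewrite truncn_itv.
by rewrite -addn1 natrD => h1 h2; apply/andP; split; lra.
Qed.

Lemma littleo_nat_le (k : nat -> nat) (g : nat -> R) (e : R) : 0 < e ->
  (fun n => (k n)%:R : R^o) =o_\oo (g : nat -> R^o) ->
  (\forall n \near \oo, 0 <= g n) ->
  \forall n \near \oo, (k n)%:R <= e * g n.
Proof.
move=> e0 /eqoP/(_ e e0) kg g0; near=> n.
have gn : 0 <= g n by near: n.
have : `|(k n)%:R : R^o| <= e * `|g n : R^o| by near: n.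
by rewrite [X in _ <= _ * X]ger0_norm// ger0_norm.
Unshelve. all: by end_near. Qed.

Lemma bottom_right B C delta (k : nat -> nat) : 0 < B -> 0 < C < 1 -> B <= C^-1 ->
  0 <= delta < 1 ->
  (fun n => (k n)%:R : R^o) =o_\oo (fun n => n%:R `^ (1 - delta) : R^o) ->
  dTV (segment_law B C delta n (nblock delta n) (nblock delta n) (k n))
      (iid_bernoulli (k n) C) @[n --> \oo] --> (0 : R).
Proof.
move=> B0 /andP[C0 C1] BC /andP[d0 d1] kn.
have CC : 0 < C * (1 - C) by rewrite mulr_gt0// subr_gt0.
apply: cvg_sqr0 => e e0.
(* The bound [1 / 2] gives [2 * k <= n]; then the two terms of the entropy bound
   are at most [2 * m / n] and [4 * m / n]. *)
pose e' := Num.min (e * (C * (1 - C)) / 6) 2^-1.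
have e'0 : 0 < e'.
  by rewrite lt_min invr_gt0 ltr0n andbT; apply: divr_gt0 => //; exact: mulr_gt0.
near=> n; set m := nblock delta n.
have n2 : (2 <= n)%N by near: n; exact: nbhs_infty_ge.
have n0 : (0 < n)%N by exact: leq_trans n2.
have m0 : (0 < m)%N by exact: nblock_gt0.
have mC : m%:R + 1 <= C * n%:R.
  have : m%:R <= C / 2 * n%:R by rewrite /m; near: n; apply: near_nblock_le; rewrite ?divr_gt0.
  have : 2 / C <= n%:R by near: n; exact: nbhs_infty_ger.
  by rewrite ler_pdivrMr//; lra.
have ke : (k n)%:R <= e' * n%:R `^ (1 - delta).
  by near: n; apply: littleo_nat_le kn _ => //; near=> j; exact: powR_ge0.
have mle := nblock_le delta n; rewrite -/m in mle.
have kmn : (k n)%:R * m%:R <= e' * n%:R.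
  apply: (@le_trans _ _ ((e' * n%:R `^ (1 - delta)) * n%:R `^ delta)).
    by apply: ler_pM.
  by rewrite -mulrA powR_natD// subrK powRr1.
have k2 : (k n)%:R <= n%:R / 2 :> R.
  apply: (@le_trans _ _ (e' * n%:R)).
    by apply: le_trans kmn; rewrite ler_peMr// -[1]/(1%:R) ler_nat.
  by rewrite [leRHS]mulrC; apply: ler_wpM2r => //; rewrite ge_min lexx orbT.
have kn2 : (2 * k n <= n)%N.
  by rewrite -(ler_nat R) natrM; lra.
rewrite /segment_law tables_two_margins.
set h := Num.truncn (B * C * n%:R); set l := Num.truncn (C * n%:R).
have hn : (h <= n)%N.
  have BC1 : B * C <= 1 by rewrite -ler_pdivlMr// mul1r.
  rewrite -(ler_nat R); apply: (@le_trans _ _ (B * C * n%:R)).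
    by rewrite truncn_le !mulr_ge0// ltW.
  by rewrite -[leRHS]mul1r ler_wpM2r.
have /andP[l1 l2] : 0 <= C * n%:R - l%:R <= 1 by apply: truncn_diff; rewrite mulr_ge0// ltW.
have ln_ : (l <= n)%N.
  rewrite -(ler_nat R); have : C * n%:R <= 1 * n%:R by rewrite ler_wpM2r// ltW.
  lra.
have ml : (m <= l)%N by rewrite -(ler_nat R); lra.
have mhnl : (m * h <= n * l)%N by rewrite mulnC leq_mul.
have A0 : (0 < #|binary_tables (two_margins h l \o @heavy m n) (two_margins h l \o @heavy m n)|)%N.
  apply: (@card_tables_gt0 R m n h l 0 (m * h) (n * l - m * h)) => //.
  - by rewrite leq_mul2l hn orbT.
  - by apply: leq_trans (leq_subr _ _) _; rewrite leq_mul2l ln_ orbT.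
  - by rewrite subnKC.
have C01 : 0 < C < 1 by rewrite C0.
apply: le_trans (dTV_uniform_iid _ A0 C01) _.
apply: le_trans (relative_entropy_light_segment A0 n0 _ C01 _) _.
- by apply: leq_trans kn2; rewrite leq_pmull.
- by rewrite ler_norml; lra.
have n1R : 2 <= n%:R :> R by rewrite -[2]/(2%:R) ler_nat.
have m1R : 1 <= m%:R :> R by rewrite -[1]/(1%:R) ler_nat.
apply: (@le_trans _ _ (\sum_(t < k n) (6 * m%:R / n%:R) / (C * (1 - C)))).
  apply: ler_sum => t _; apply: ler_wpM2r; first by rewrite invr_ge0 ltW.
  have h1 : (n - t)%:R^-1 <= 2 / n%:R :> R.
    have tn : (n <= 2 * (n - t))%N by move: (ltn_ord t) kn2; clear; lia.
    have nt : (0 < n - t)%N by move: tn n0; clear; lia.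
    by rewrite -[leLHS]mul1r ler_pdivrMr ?ltr0n// mulrAC ler_pdivlMr ?ltr0n// mul1r -natrM ler_nat.
  have h2 : m.+1%:R / n.-1%:R <= 4 * m%:R / n%:R :> R.
    have n1 : (0 < n.-1)%N by move: n2; clear; lia.
    rewrite ler_pdivrMr ?ltr0n// mulrAC ler_pdivlMr ?ltr0n// -!natrM ler_nat.
    by move: n2 m0; clear; nia.
  have h3 : 2 / n%:R <= 2 * m%:R / n%:R :> R.
    by rewrite ler_wpM2r ?invr_ge0// ler_peMr.
  move: h1 h2 h3; clear; rewrite -!mulrA; lra.
have -> : \sum_(t < k n) (6 * m%:R / n%:R) / (C * (1 - C)) =
    6 * ((k n)%:R * m%:R / n%:R) / (C * (1 - C)).
  by rewrite sumr_const card_ord -[LHS]mulr_natr; ring.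
have : e' <= e * (C * (1 - C)) / 6 by rewrite ge_min lexx.
rewrite ler_pdivrMr// => e'e.
have : (k n)%:R * m%:R / n%:R <= e' by rewrite ler_pdivrMr// ltr0n.
move: e'e; clear; lra.
Unshelve. all: by end_near. Qed.

End Asymptotics.

(** * Densities of the blocks *)

Section TopBlocks.
Variable R : realType.
Implicit Types (B C delta e : R) (n : nat).

Lemma nblock_cube delta n : delta <= 2 / 3 -> (0 < n)%N ->
  (nblock delta n ^ 3 <= n ^ 2)%N.
Proof.
move=> d23 n0; rewrite -(ler_nat R) !natrX.
apply: (@le_trans _ _ ((n%:R `^ delta) ^+ 3)).
  by rewrite lerXn2r ?nnegrE ?powR_ge0// nblock_le.
rewrite -!powR_mulrn ?powR_ge0// -powRrM; apply: ler_powR_nat => //.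
by rewrite -ler_pdivlMr.
Qed.

Definition top_left_limit B C : R := B ^+ 2 * (1 - C) / (B ^+ 2 - 2 * B + C^-1).

Section BlockDensities.
Variables (B C eta : R).
Hypotheses (B0 : 0 < B) (C0 : 0 < C) (C1 : C < 1) (BC1 : B * C < 1).
Hypotheses (eta0 : 0 <= eta) (eta2 : eta <= 2^-1).

(** The side blocks get their limiting density [B * C] exactly.  With
    [eta = B * m / n], the density of the bottom right block is what the light row
    sums leave to it, and the density of the top left block is the one whose odds
    complete a product form. *)
Definition bottom_right_prob : R := C * (1 - eta).

Definition top_left_odds : R :=
  (B * C / (1 - B * C)) ^+ 2 / (bottom_right_prob / (1 - bottom_right_prob)).

Definition top_left_prob : R := top_left_odds / (1 + top_left_odds).

Let odds0 : R := (B * C / (1 - B * C)) ^+ 2 / (C / (1 - C)).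
Let rho : R := 1 + eta / ((1 - C) * (1 - eta)).

Let BC0 : 0 < B * C. Proof. exact: mulr_gt0. Qed.
Let odds0_gt0 : 0 < odds0.
Proof. by rewrite !divr_gt0 ?exprn_gt0 ?divr_gt0 ?subr_gt0. Qed.

Let C1' : 0 < 1 - C. Proof. by rewrite subr_gt0. Qed.
Let BC1' : 0 < 1 - B * C. Proof. by rewrite subr_gt0. Qed.
Let eta1' : 0 < 1 - eta. Proof. by have := eta2; lra. Qed.
Let d1' : 0 < 1 - C * (1 - eta).
Proof. by have : C * eta >= 0; [exact: mulr_ge0 (ltW C0) eta0|have := C1; lra]. Qed.

Let top_left_oddsE : top_left_odds = odds0 * rho.
Proof.
by rewrite /top_left_odds /odds0 /rho /bottom_right_prob; field; rewrite !gt_eqF// subr_gt0.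
Qed.

Let rho_ge1 : 1 <= rho.
Proof. by rewrite lerDl divr_ge0// mulr_ge0// ltW. Qed.

Let rho_le : rho <= 1 + 2 * eta / (1 - C).
Proof.
rewrite lerD2l ler_pdivrMr ?mulr_gt0//.
have -> : 2 * eta / (1 - C) * ((1 - C) * (1 - eta)) = 2 * (1 - eta) * eta by field; rewrite gt_eqF.
by rewrite ler_peMl//; have := eta2; lra.
Qed.

Lemma bottom_right_prob_itv : C / 2 <= bottom_right_prob <= C.
Proof. have [[c e] e'] := (C0, eta0, eta2); rewrite /bottom_right_prob; apply/andP; split; nra. Qed.

(** The limit is the value at [eta = 0]. *)
Lemma top_left_limitE : top_left_limit B C = odds0 / (1 + odds0).
Proof.
have D : 0 < B ^+ 2 * (1 - C) * C + (1 - B * C) ^+ 2.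
  by rewrite addr_gt0 ?exprn_gt0// !mulr_gt0// exprn_gt0.
have E : B ^+ 2 - 2 * B + C^-1 = (B ^+ 2 * (1 - C) * C + (1 - B * C) ^+ 2) / C.
  by field; rewrite gt_eqF.
have D' : 0 < (1 - B * C) ^+ 2 + B ^+ 2 * C * (1 - C).
  by rewrite addrC mulrAC.
by rewrite /top_left_limit E /odds0; field; rewrite !gt_eqF.
Qed.

Lemma top_left_limit_itv : 0 < top_left_limit B C < 1.
Proof.
rewrite top_left_limitE; have := odds0_gt0; move: odds0 => o o0; apply/andP; split.
  by rewrite divr_gt0// ltr_wpDl.
by rewrite ltr_pdivrMr ?mul1r ?ltrDr// ltr_wpDl.
Qed.

Lemma top_left_odds_gt0 : 0 < top_left_odds.
Proof. by rewrite top_left_oddsE mulr_gt0// (lt_le_trans ltr01). Qed.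

Lemma top_left_prob_itv : top_left_limit B C <= top_left_prob < 1.
Proof.
have := top_left_odds_gt0; rewrite /top_left_prob top_left_limitE top_left_oddsE.
have := odds0_gt0; have := rho_ge1; move: odds0 rho => o r r1 o0 or0.
have o1 : 0 < 1 + o by lra.
have or1 : 0 < 1 + o * r by lra.
apply/andP; split; last by rewrite ltr_pdivrMr// mul1r; lra.
by rewrite ler_pdivrMr// mulrAC ler_pdivlMr//; nra.
Qed.

Lemma top_left_prob_le : top_left_prob <= (1 + 2 * eta / (1 - C)) * top_left_limit B C.
Proof.
apply: (@le_trans _ _ (rho * top_left_limit B C)); last first.
  by rewrite ler_wpM2r//; have /andP[/ltW] := top_left_limit_itv.
rewrite /top_left_prob top_left_limitE top_left_oddsE.
have := odds0_gt0; have := rho_ge1; move: odds0 rho => o r r1 o0.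
have o1 : 0 < 1 + o by lra.
have or1 : 0 < 1 + o * r by nra.
rewrite mulrA (mulrC o) ler_pM2l ?mulr_gt0//; last by lra.
by rewrite lef_pV2 ?posrE//; nra.
Qed.

Lemma top_left_prob_odds :
  top_left_prob / (1 - top_left_prob) * (bottom_right_prob / (1 - bottom_right_prob)) =
  (B * C / (1 - B * C)) ^+ 2.
Proof.
have o0 := top_left_odds_gt0.
have -> : top_left_prob / (1 - top_left_prob) = top_left_odds.
  rewrite /top_left_prob; field; by apply/andP; split; rewrite gt_eqF//; lra.
rewrite /top_left_odds divfK// mulf_neq0 ?invr_neq0 ?gt_eqF// ?subr_gt0; have /andP[] := bottom_right_prob_itv; have [c0 c1] := (C0, C1); lra.
Qed.

(** Since [eta <= 1 / 2], the odds exceed their limit at most by the factor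
    [1 + 1 / (1 - C)], which keeps the density away from 1. *)
Lemma top_left_prob_var :
  top_left_limit B C / (1 + odds0 * (1 + (1 - C)^-1)) <= top_left_prob * (1 - top_left_prob).
Proof.
have /andP[g0 g1] := top_left_limit_itv; have /andP[ga a1] := top_left_prob_itv.
have o0 := top_left_odds_gt0.
have -> : 1 - top_left_prob = (1 + top_left_odds)^-1.
  rewrite /top_left_prob; field; rewrite gt_eqF//; lra.
have rle : rho <= 1 + (1 - C)^-1.
  apply: le_trans rho_le _; rewrite lerD2l ler_piMl ?invr_ge0 ?(ltW C1')//; have := eta2; lra.
apply: ler_pM => //; first exact: ltW.
  by rewrite invr_ge0 addr_ge0// mulr_ge0 ?ltW// addr_gt0// invr_gt0.
rewrite lef_pV2 ?posrE; first by rewrite lerD2l top_left_oddsE ler_wpM2l// ltW.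
  by rewrite ltr_wpDr// mulr_ge0 ?ltW// addr_gt0// invr_gt0.
lra.
Qed.

End BlockDensities.
(** * Top left and side blocks *)

Lemma near_ln_ge1 : \forall n \near \oo, 1 <= ln n%:R :> R.
Proof.
near=> n; have H : expR 1 <= n%:R :> R by near: n; exact: nbhs_infty_ger.
by rewrite -[leLHS](expRK 1) ler_ln ?posrE ?expR_gt0// (lt_le_trans _ H)// expR_gt0.
Unshelve. all: by end_near. Qed.

(** The side blocks are given their limiting density at once, but in the top left
    block the product form of the odds forces a density [a] that depends on [n]
    and approaches its limit from above. *)
Lemma segments_entropy_eventually B C delta :
  0 < B -> 0 < C < 1 -> B * C < 1 -> 0 <= delta <= 2 / 3 ->
  exists2 K : R, 0 < K & \forall n \near \oo, exists a : R,
  [/\ top_left_limit B C <= a < 1,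
      a <= (1 + K * ((nblock delta n)%:R / n%:R)) * top_left_limit B C,
      (0 < #|tables B C delta n|)%N &
      forall k b,
      (nblock delta n * (two_margins (nblock delta n) n b %/ k))%:R *
        relative_entropy (segment_law B C delta n 0 (if b then 0 else nblock delta n) k)
          (iid_bernoulli k (if b then a else B * C)) <= K * (n%:R * ln n%:R)].
Proof.
move=> B0 /andP[C0 C1] BC1 /andP[d0 d23].
have d1 : delta < 1 by lra.
have BC0 : 0 < B * C by exact: mulr_gt0.
have C1' : 0 < 1 - C by lra.
have BC1' : 0 < 1 - B * C by lra.
pose odds0 : R := (B * C / (1 - B * C)) ^+ 2 / (C / (1 - C)).
pose c1 := top_left_limit B C / (1 + odds0 * (1 + (1 - C)^-1)).
pose c2 := B * C * (1 - B * C).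
pose c3 := C / 2 * (1 - C).
(* [c] is a lower bound of the variances of the entries in all the blocks. *)
pose c := Num.min c1 (Num.min c2 c3).
have /andP[g0 g1] := top_left_limit_itv B0 C0 C1 BC1.
have c1_gt0 : 0 < c1.
  apply: divr_gt0 => //; have o0 : 0 <= odds0.
    by rewrite !divr_ge0 ?exprn_ge0 ?divr_ge0// ltW.
  have i0 : 0 <= (1 - C)^-1 by rewrite invr_ge0 ltW.
  by rewrite ltr_wpDr// mulr_ge0// addr_ge0.
have c2_gt0 : 0 < c2 by exact: mulr_gt0.
have c3_gt0 : 0 < c3 by rewrite mulr_gt0// divr_gt0.
have c0 : 0 < c by rewrite !lt_min c1_gt0 c2_gt0.
pose K := Num.max (24 + 19 / c) (2 * B / (1 - C)).
have Kc : 24 + 19 / c <= K by rewrite le_max lexx.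
have KB : 2 * B / (1 - C) <= K by rewrite le_max lexx orbT.
exists K; first by apply: lt_le_trans Kc; rewrite addr_gt0// divr_gt0.
near=> n; set m := nblock delta n.
have n0 : (0 < n)%N by near: n; exact: nbhs_infty_gt.
have n0R : 0 < n%:R :> R by rewrite ltr0n.
have m0 : (0 < m)%N by exact: nblock_gt0.
have mn : (m <= n)%N.
  rewrite -(ler_nat R) -[leRHS]mul1r /m; near: n; exact: near_nblock_le.
have mB : m%:R <= (2 * B)^-1 * n%:R.
  by rewrite /m; near: n; apply: near_nblock_le; rewrite ?invr_gt0 ?mulr_gt0.
have small (x : R) : 0 < x -> m%:R <= x / 2 * n%:R -> 2 / x <= n%:R -> m%:R + 1 <= x * n%:R.
  by move=> x0 h; rewrite ler_pdivrMr//; lra.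
have mC : m%:R + 1 <= C * n%:R.
  apply: small => //; rewrite /m; near: n; last exact: nbhs_infty_ger.
  by apply: near_nblock_le; rewrite ?divr_gt0.
have mBC : m%:R + 1 <= B * C * n%:R.
  apply: small => //; rewrite /m; near: n; last exact: nbhs_infty_ger.
  by apply: near_nblock_le; rewrite ?divr_gt0.
have ln1 : 1 <= ln n%:R :> R by near: n; exact: near_ln_ge1.
have L0 : 0 <= n%:R * ln n%:R :> R by rewrite mulr_ge0// (le_trans _ ln1).
pose eta : R := B * (m%:R / n%:R).
have eta0 : 0 <= eta by rewrite mulr_ge0 ?divr_ge0// ltW.
have eta2 : eta <= 2^-1.
  rewrite /eta mulrA ler_pdivrMr// mulrC -ler_pdivlMr// mulrAC.
  by rewrite -invfM.
have /andP[d_ge d_le] := bottom_right_prob_itv C0 eta0 eta2.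
have /andP[ga a1] := top_left_prob_itv B0 C0 C1 BC1 eta0 eta2.
set a := top_left_prob B C eta in ga a1 *; set d := bottom_right_prob C eta in d_ge d_le *.
have a0 : 0 < a by exact: lt_le_trans ga.
have d0' : 0 < d by apply: lt_le_trans d_ge; rewrite divr_gt0.
set h := Num.truncn (B * C * n%:R); set l := Num.truncn (C * n%:R).
have hB : 0 <= B * C * n%:R - h%:R <= 1 by apply: truncn_diff; rewrite mulr_ge0// ltW.
have lC : 0 <= C * n%:R - l%:R <= 1 by apply: truncn_diff; rewrite mulr_ge0// ltW.
have hBn : B * C * n%:R <= n%:R by rewrite ler_piMl// ltW.
have lCn : C * n%:R <= n%:R by rewrite ler_piMl// ltW.
have mh : (m <= h <= n)%N by rewrite -!(ler_nat R); case/andP: hB => *; apply/andP; split; lra.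
have ml : (m <= l <= n)%N by rewrite -!(ler_nat R); case/andP: lC => *; apply/andP; split; lra.
have nd : n%:R * d = C * n%:R - B * C * m%:R.
  by rewrite /d /bottom_right_prob /eta; field; rewrite gt_eqF.
have a01 : 0 < a < 1 by rewrite a0.
have s01 : 0 < B * C < 1 by rewrite BC0.
have d01 : 0 < d < 1 by rewrite d0' (le_lt_trans d_le).
have ca : c <= a * (1 - a).
  apply: le_trans (top_left_prob_var B0 C0 C1 BC1 eta0 eta2).
  by rewrite ge_min lexx.
have cs : c <= B * C * (1 - B * C) by rewrite !ge_min lexx orbT.
have cd : c <= d * (1 - d).
  apply: (@le_trans _ _ c3); first by rewrite !ge_min lexx !orbT.
  apply: ler_pM => //; [by rewrite divr_ge0// ltW|exact: ltW|lra].
have [A0 [w0 [w00 Ww0 cost]]] := tables_cost c0 a01 s01 d01 ca cs cd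
  (top_left_prob_odds B0 C0 C1 BC1 eta0 eta2) nd m0 mn (nblock_cube d23 n0) ln1 mh ml hB lC.
exists a; split => //.
- by rewrite ga.
- apply: le_trans (top_left_prob_le B0 C0 C1 BC1 eta0 eta2) _.
  apply: ler_wpM2r; first exact: ltW.
  rewrite lerD2l /eta (_ : 2 * _ / _ = 2 * B / (1 - C) * (m%:R / n%:R)); last by ring.
  by apply: ler_wpM2r => //; rewrite divr_ge0.
- move=> k b.
  have seg := relative_entropy_segment m0 A0 k b a01 s01 d01 w00 Ww0.
  rewrite /segment_law tables_two_margins; apply: (le_trans seg).
  by apply: le_trans cost _; apply: ler_wpM2r.
Unshelve. all: by end_near. Qed.

Lemma windows_count (q k len : nat) : (0 < k <= len)%N ->
  (q * len <= 2 * k * (q * (len %/ k)))%N.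
Proof.
move=> /andP[k0 kl]; rewrite mulnCA leq_mul2l; apply/orP; right.
have : (0 < len %/ k)%N by rewrite divn_gt0.
have := ltn_ceil len k0; nia.
Qed.

Lemma top_left B C delta (k : nat -> nat) :
  0 < B -> 0 < C < 1 -> B * C < 1 -> 2^-1 < delta <= 2 / 3 ->
  (forall n, (0 < n)%N -> (0 < k n)%N) ->
  (fun n => (k n)%:R : R^o) =o_\oo (fun n => n%:R `^ (2 * delta - 1) / ln n%:R : R^o) ->
  dTV (segment_law B C delta n 0 0 (k n)) (iid_bernoulli (k n) (top_left_limit B C))
    @[n --> \oo] --> (0 : R).
Proof.
move=> B0 /andP[C0 C1] BC1 /andP[d12 d23] k_gt0 kn.
have C01 : 0 < C < 1 by rewrite C0.
have d0 : 0 <= delta by lra.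
have d01 : 0 <= delta <= 2 / 3 by rewrite d0.
have [K K0 HK] := segments_entropy_eventually B0 C01 BC1 d01.
have /andP[g0 g1] := top_left_limit_itv B0 C0 C1 BC1.
apply: cvg_sqr0 => e e0.
(* [9 = 8 + 1]: the entropy of the window, and the change of parameter; the bound
   [1 / 2] makes the windows shorter than the rows of the block. *)
pose e' := Num.min (e / (9 * K)) 2^-1.
have e'0 : 0 < e' by rewrite lt_min invr_gt0 ltr0n andbT; apply: divr_gt0 => //; exact: mulr_gt0.
apply: filter_app HK; near=> n; set m := nblock delta n.
move=> [a [/andP[ga a1] age A0 ent]].
have n0 : (0 < n)%N by near: n; exact: nbhs_infty_gt.
have n0R : 0 < n%:R :> R by rewrite ltr0n.
have k0 := k_gt0 _ n0.
have ln1 : 1 <= ln n%:R :> R by near: n; exact: near_ln_ge1.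
have ln0 : 0 < ln n%:R :> R by exact: lt_le_trans ln1.
have ke : (k n)%:R <= e' * (n%:R `^ (2 * delta - 1) / ln n%:R).
  near: n; apply: littleo_nat_le kn _ => //; near=> j.
  by rewrite divr_ge0 ?powR_ge0// (le_trans (@ler01 R))//; near: j; exact: near_ln_ge1.
have m0 : (0 < m)%N by exact: nblock_gt0.
have m0R : 0 < m%:R :> R by rewrite ltr0n.
have mge : n%:R `^ delta <= 2 * m%:R by exact: nblock_ge.
have mle : m%:R <= n%:R `^ delta by exact: nblock_le.
have kln : (k n)%:R * ln n%:R <= e' * n%:R `^ (2 * delta - 1).
  by move: ke; rewrite mulrA ler_pdivlMr.
have kpow : (k n)%:R <= e' * n%:R `^ (2 * delta - 1).
  by apply: le_trans kln; rewrite ler_peMr.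
have km : (k n <= m)%N.
  rewrite -(ler_nat R); apply: le_trans kpow _.
  apply: (@le_trans _ _ (2^-1 * n%:R `^ delta)); last lra.
  apply: ler_pM; rewrite ?powR_ge0//; first exact: ltW.
    by rewrite ge_min lexx orbT.
  by apply: ler_powR_nat => //; lra.
have a01 : 0 < a < 1 by rewrite (lt_le_trans g0 ga).
have ka : forall x, iid_bernoulli (k n) a x <=
    (1 + K * (m%:R / n%:R)) ^+ (k n) * iid_bernoulli (k n) (top_left_limit B C) x.
  move=> x; rewrite -[X in _ ^+ X]card_ord -prodr_const -big_split/=.
  apply: ler_prod => t _; rewrite ltW ?bernoulli_pmf_gt0//=.
  case: (x t) => //=; apply: (@le_trans _ _ (1 - top_left_limit B C)); first lra.
  by rewrite ler_peMl ?subr_ge0 ?(ltW g1)// lerDl mulr_ge0 ?divr_ge0// ltW.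
have g01 : 0 < top_left_limit B C < 1 by rewrite g0.
rewrite /segment_law; apply: le_trans (dTV_uniform_iid _ A0 g01) _.
have ke0 : 0 <= K * (m%:R / n%:R) by rewrite mulr_ge0 ?divr_ge0// ltW.
apply: le_trans (relative_entropy_change (q := iid_bernoulli (k n) a) ke0 _ _ _ _ ka) _.
- by move=> x; exact: law_ge0.
- by move=> x; exact: iid_bernoulli_gt0.
- by move=> x; exact: iid_bernoulli_gt0.
- exact: law_total.
have := ent (k n) true; rewrite /segment_law /=.
set RE := relative_entropy _ _ => REle.
have RE0 : 0 <= RE.
  by apply: le_trans (dTV_uniform_iid _ A0 a01); exact: sqr_ge0.
have h1 : RE <= 8 * K * e'.
  have := @windows_count m (k n) m; rewrite k0 km => /(_ isT); rewrite -(ler_nat R) !natrM => cnt.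
  have : m%:R * m%:R * RE <= 2 * (k n)%:R * (K * (n%:R * ln n%:R)).
    apply: le_trans (ler_wpM2r RE0 cnt) _; rewrite -[leLHS]mulrA; apply: ler_wpM2l => //.
    by move: REle; rewrite natrM.
  move=> H; have mm0 : 0 < m%:R * m%:R :> R by rewrite mulr_gt0.
  rewrite -(ler_pM2l mm0); apply: le_trans H _.
  have -> : 2 * (k n)%:R * (K * (n%:R * ln n%:R)) = 2 * K * ((k n)%:R * ln n%:R * n%:R) by ring.
  have -> : m%:R * m%:R * (8 * K * e') = 2 * K * (e' * ((2 * m%:R) * (2 * m%:R))) by ring.
  apply: ler_wpM2l; first by rewrite mulr_ge0// ltW.
  apply: (@le_trans _ _ (e' * n%:R `^ (2 * delta - 1) * n%:R)).
    by apply: ler_wpM2r.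
  rewrite -mulrA -[X in _ * (_ * X)]powRr1// powR_natD// subrK mulrDl mul1r -powR_natD//.
  by apply: ler_wpM2l; [exact: ltW|apply: ler_pM; rewrite ?powR_ge0].
have h2 : (k n)%:R * (K * (m%:R / n%:R)) <= K * e'.
  rewrite mulrCA; apply: ler_wpM2l; first exact: ltW.
  rewrite mulrA ler_pdivrMr//.
  apply: (@le_trans _ _ (e' * n%:R `^ (2 * delta - 1) * n%:R `^ delta)).
    by apply: ler_pM.
  rewrite -mulrA powR_natD//; apply: ler_wpM2l; first exact: ltW.
  by rewrite -[leRHS]powRr1//; apply: ler_powR_nat => //; lra.
apply: le_trans (lerD h1 h2) _.
have : e' <= e / (9 * K) by rewrite ge_min lexx.
rewrite ler_pdivlMr ?mulr_gt0//; lra.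
Unshelve. all: by end_near. Qed.


Lemma side_block B C delta (k : nat -> nat) :
  0 < B -> 0 < C < 1 -> B * C < 1 -> 0 < delta <= 2^-1 ->
  (forall n, (0 < n)%N -> (0 < k n)%N) ->
  (fun n => (k n)%:R : R^o) =o_\oo (fun n => n%:R `^ delta / ln n%:R : R^o) ->
  dTV (segment_law B C delta n 0 (nblock delta n) (k n)) (iid_bernoulli (k n) (B * C))
    @[n --> \oo] --> (0 : R).
Proof.
move=> B0 C01 BC1 /andP[dpos d12] k_gt0 kn.
have d0 : 0 <= delta by lra.
have d01 : 0 <= delta <= 2 / 3 by apply/andP; split; lra.
have [K K0 HK] := segments_entropy_eventually B0 C01 BC1 d01.
have s01 : 0 < B * C < 1 by rewrite BC1 mulr_gt0//; case/andP: C01.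
apply: cvg_sqr0 => e e0.
pose e' := Num.min (e / (4 * K)) 1.
have e'0 : 0 < e' by rewrite lt_min ltr01 andbT; apply: divr_gt0 => //; exact: mulr_gt0.
apply: filter_app HK; near=> n; set m := nblock delta n => -[a [_ _ A0 ent]].
have n0 : (0 < n)%N by near: n; exact: nbhs_infty_gt.
have n0R : 0 < n%:R :> R by rewrite ltr0n.
have k0 := k_gt0 _ n0.
have ln1 : 1 <= ln n%:R :> R by near: n; exact: near_ln_ge1.
have ln0 : 0 < ln n%:R :> R by exact: lt_le_trans ln1.
have ke : (k n)%:R <= e' * (n%:R `^ delta / ln n%:R).
  near: n; apply: littleo_nat_le kn _ => //; near=> j.
  by rewrite divr_ge0 ?powR_ge0// (le_trans (@ler01 R))//; near: j; exact: near_ln_ge1.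
have m0 : (0 < m)%N by exact: nblock_gt0.
have m0R : 0 < m%:R :> R by rewrite ltr0n.
have mge : n%:R `^ delta <= 2 * m%:R by exact: nblock_ge.
have kln : (k n)%:R * ln n%:R <= e' * n%:R `^ delta.
  by move: ke; rewrite mulrA ler_pdivlMr.
have kpow : (k n)%:R <= e' * n%:R `^ delta.
  by apply: le_trans kln; rewrite ler_peMr.
have kn_le : (k n <= n)%N.
  rewrite -(ler_nat R); apply: le_trans kpow _.
  rewrite -[leRHS]mul1r; apply: ler_pM; rewrite ?powR_ge0//; first exact: ltW.
    by rewrite ge_min lexx orbT.
  by rewrite -[leRHS]powRr1//; apply: ler_powR_nat => //; lra.
rewrite /segment_law; apply: le_trans (dTV_uniform_iid _ A0 s01) _.
have := ent (k n) false; rewrite /segment_law /=.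
set RE := relative_entropy _ _ => REle.
have RE0 : 0 <= RE.
  by apply: le_trans (dTV_uniform_iid _ A0 s01); exact: sqr_ge0.
apply: (@le_trans _ _ (4 * K * e')); last first.
  have : e' <= e / (4 * K) by rewrite ge_min lexx.
  by rewrite ler_pdivlMr ?mulr_gt0//; lra.
have := @windows_count m (k n) n; rewrite k0 kn_le => /(_ isT); rewrite -(ler_nat R) !natrM => cnt.
have H : m%:R * n%:R * RE <= 2 * (k n)%:R * (K * (n%:R * ln n%:R)).
  apply: le_trans (ler_wpM2r RE0 cnt) _; rewrite -[leLHS]mulrA; apply: ler_wpM2l => //.
  by move: REle; rewrite natrM.
have mn0 : 0 < m%:R * n%:R :> R by rewrite mulr_gt0.
rewrite -(ler_pM2l mn0); apply: le_trans H _.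
have -> : 2 * (k n)%:R * (K * (n%:R * ln n%:R)) = 2 * K * n%:R * ((k n)%:R * ln n%:R) by ring.
have -> : m%:R * n%:R * (4 * K * e') = 2 * K * n%:R * (e' * (2 * m%:R)) by ring.
apply: ler_wpM2l; first by rewrite !mulr_ge0// ltW.
by apply: le_trans kln _; apply: ler_wpM2l => //; exact: ltW.
Unshelve. all: by end_near. Qed.

End TopBlocks.

Theorem theorem1p4 (R : realType) (B C delta : R) (k : nat -> nat)
    (B_gt0 : 0 < B) (C_gt0 : 0 < C) (k_gt0 : forall n, (0 < n)%N -> (0 < k n)%N) :
  [/\ (* bottom right *)
      0 <= delta < 1 -> C < 1 -> B <= C^-1 ->
      (fun n => (k n)%:R : R^o) =o_\oo (fun n => n%:R `^ (1 - delta) : R^o) ->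
      dTV (segment_law B C delta n (nblock delta n) (nblock delta n) (k n))
          (iid_bernoulli (k n) C) @[n --> \oo] --> (0 : R),
      (* top left *)
      2^-1 < delta <= 2 / 3 -> C < 3 / 4 ->
      B < (Num.sqrt (C / 3 - C ^+ 2 / 3) + C)^-1 ->
      (fun n => (k n)%:R : R^o) =o_\oo
        (fun n => n%:R `^ (2 * delta - 1) / ln n%:R : R^o) ->
      dTV (segment_law B C delta n 0 0 (k n))
          (iid_bernoulli (k n)
             (B ^+ 2 * (1 - C) / (B ^+ 2 - 2 * B + C^-1)))
        @[n --> \oo] --> (0 : R)
    & (* side block *)
      0 < delta <= 2^-1 -> C < 3 / 4 ->
      B < (Num.sqrt (C / 3 - C ^+ 2 / 3) + C)^-1 ->
      (fun n => (k n)%:R : R^o) =o_\oo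
        (fun n => n%:R `^ delta / ln n%:R : R^o) ->
      dTV (segment_law B C delta n 0 (nblock delta n) (k n))
          (iid_bernoulli (k n) (B * C)) @[n --> \oo] --> (0 : R)].
Proof.
have BC1 : B < (Num.sqrt (C / 3 - C ^+ 2 / 3) + C)^-1 -> B * C < 1.
  move=> HB; have den : C <= Num.sqrt (C / 3 - C ^+ 2 / 3) + C by rewrite lerDr sqrtr_ge0.
  rewrite -ltr_pdivlMr// mul1r; apply: lt_le_trans HB _.
  by rewrite lef_pV2 ?posrE// (lt_le_trans C_gt0).
split.
- by move=> d01 C1 BC kn; apply: bottom_right => //; rewrite C_gt0.
- move=> d C34 HB kn; apply: top_left (BC1 HB) d k_gt0 kn => //.
  by rewrite C_gt0/=; lra.
move=> d C34 HB kn; apply: side_block (BC1 HB) d k_gt0 kn => //.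
by rewrite C_gt0/=; lra.
Qed.
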